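(* Let $A$ and $B$ be distinct rigidity circuits on vertices in $[n]$, let $e\in E(A)\cap E(B)$, and suppose $C=\mathrm{CR}(A,B,e)$ is a rigidity circuit. Let $p_A,p_B,p_C\in CM_n$ be the corresponding circuit polynomials. Then the resultant $\mathrm{Res}(p_A,p_B,x_e)$ is a nonzero polynomial lying in $CM_n\cap\mathbb{Q}[C]$; $p_C$ divides it; and every irreducible factor over $\mathbb{Q}$ of $\mathrm{Res}(p_A,p_B,x_e)$ that belongs to $CM_n$ is a nonzero rational multiple of $p_C$. Consequently, following a resultant tree of a rigidity circuit $C$, the circuit polynomial $p_C$ can be obtained inductively from the circuit polynomials of $K_4$ graphs by taking resultants and, at each step, selecting the unique (up to scalar) irreducible factor lying in the Cayley–Menger ideal.
   Context: Rigidity circuit: a graph $C=(V,E)$ (vertex set = endpoints of edges) with $|E|=2|V|-2$ such that every proper subset $V'\subsetneq V$ with $|V'|\ge 2$ spans at most $2|V'|-3$ edges. Combinatorial resultant $\mathrm{CR}(G_1,G_2,e)$ of distinct graphs with common edge $e$: vertex set $V_1\cup V_2$, edge set $(E_1\cup E_2)\setminus\{e\}$. A resultant tree of $C$ is a rooted binary tree with root $C$ whose nodes are rigidity circuits, each internal node being the combinatorial resultant of its two children on a common edge, and whose leaves are $K_4$'s. Let $X_n=\{x_{ij}:1\le i<j\le n\}$, where $x_{ij}$ is identified with the edge $ij$ of $K_n$; a set of variables is identified with the graph on the corresponding edges, and $\mathbb{Q}[S]$ denotes polynomials in the variables of $S$. The 2D Cayley–Menger ideal $CM_n\subset\mathbb{Q}[X_n]$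 is generated by all $5\times 5$ minors of the $(n+1)\times(n+1)$ symmetric Cayley–Menger matrix whose first row and column are $(0,1,\dots,1)$, with zero diagonal and $(i+1,j+1)$ entry $x_{ij}$ for $i<j$; it is a prime ideal. Its algebraic matroid on $X_n$ has as independent sets the $X\subseteq X_n$ with $CM_n\cap\mathbb{Q}[X]=\{0\}$, and its circuits are exactly the (edge sets of) rigidity circuits. For a circuit $C$, the circuit polynomial $p_C$ is the irreducible polynomial in $CM_n$ whose support (set of variables occurring) is exactly $C$; it is unique up to a nonzero rational scalar and generates $CM_n\cap\mathbb{Q}[C]$. $\mathrm{Res}(f,g,x)$ denotes the resultant of $f,g$ with respect to $x$, i.e. the determinant of their Sylvester matrix as polynomials in $x$. *)

(* Defs.v *)
From HB Require Import structures.
From mathcomp Require Import all_boot all_order all_algebra.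
From mathcomp Require Import mpoly.

Set Implicit Arguments.
Unset Strict Implicit.
Unset Printing Implicit Defensive.

Import GRing.Theory.
Local Open Scope ring_scope.

Section CM.
Variable n : nat.

Definition edge := {e : 'I_n * 'I_n | (e.1 < e.2)%N}.

Definition nv := #|{: edge}|.
Definition Xpoly := {mpoly rat[nv]}.

Definition vidx (e : edge) : 'I_nv := enum_rank e.
Definition xvar (e : edge) : Xpoly := 'X_(vidx e).

Definition xx (i j : 'I_n) : Xpoly :=
  if @insub _ (fun e : 'I_n * 'I_n => (e.1 < e.2)%N) edge (i, j) is Some e then xvar e
  else if @insub _ (fun e : 'I_n * 'I_n => (e.1 < e.2)%N) edge (j, i) is Some e then xvar e
  else 0.

(* The (n+1)x(n+1) Cayley-Menger matrix: index 0 is the bordering row/column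
   (0,1,...,1); entry (i+1,j+1) is x_ij (zero diagonal). *)
Definition CMmat : 'M[Xpoly]_(n.+1) :=
  \matrix_(a, b) match unlift ord0 a, unlift ord0 b with
                 | Some i, Some j => xx i j
                 | None, None => 0
                 | _, _ => 1
                 end.

Definition incr5 (f : 'I_5 -> 'I_n.+1) := forall a b : 'I_5, (a < b)%N -> (f a < f b)%N.

Definition minor5 (f g : 'I_5 -> 'I_n.+1) : Xpoly :=
  \det (\matrix_(a, b) CMmat (f a) (g b)).

Definition inCM (p : Xpoly) : Prop :=
  exists (k : nat) (c : 'I_k -> Xpoly) (f g : 'I_k -> 'I_5 -> 'I_n.+1),
    (forall i, incr5 (f i) /\ incr5 (g i)) /\
    p = \sum_(i < k) c i * minor5 (f i) (g i).

(* Graphs = edge sets; vertex set = endpoints of edges. *)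
Definition vert (E : {set edge}) : {set 'I_n} :=
  [set v | [exists e in E, (v == (val e).1) || (v == (val e).2)]].

Definition spanE (E : {set edge}) (V : {set 'I_n}) : {set edge} :=
  [set e in E | ((val e).1 \in V) && ((val e).2 \in V)].

Definition rigidity_circuit (E : {set edge}) : Prop :=
  (#|E| + 2 = 2 * #|vert E|)%N /\
  forall V' : {set 'I_n}, V' \proper vert E -> (2 <= #|V'|)%N ->
    (#|spanE E V'| + 3 <= 2 * #|V'|)%N.

Definition CR (E1 E2 : {set edge}) (e : edge) : {set edge} := (E1 :|: E2) :\ e.

Definition supp (p : Xpoly) : {set edge} :=
  [set e | has (fun m : 'X_{1..nv} => (0 < m (vidx e))%N) (msupp p)].

Definition irreducibleMP (p : Xpoly) : Prop :=
  p != 0 /\ p \isn't a GRing.unit /\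
  forall a b : Xpoly, p = a * b -> a \is a GRing.unit \/ b \is a GRing.unit.

Definition dvdMP (a b : Xpoly) : Prop := exists q : Xpoly, b = q * a.

Definition circuit_poly (C : {set edge}) (p : Xpoly) : Prop :=
  inCM p /\ irreducibleMP p /\ supp p = C.

(* View p as a univariate polynomial in x_e with coefficients in Q[X_n]
   (coefficients not involving x_e). *)
Definition zero_at (i : 'I_nv) (m : 'X_{1..nv}) : 'X_{1..nv} :=
  [multinom (if j == i then 0%N else m j) | j < nv].

Definition univ (e : edge) (p : Xpoly) : {poly Xpoly} :=
  \sum_(m <- msupp p) (p@_m *: 'X_[zero_at (vidx e) m])%:P * 'X^(m (vidx e)).

Definition Res (f g : Xpoly) (e : edge) : Xpoly := resultant (univ e f) (univ e g).

Inductive rtree : Type :=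
  | RLeaf of {set edge}
  | RNode of {set edge} & edge & rtree & rtree.

Definition rroot (t : rtree) : {set edge} :=
  match t with RLeaf G => G | RNode G _ _ _ => G end.

Definition isK4 (G : {set edge}) : Prop :=
  exists V : {set 'I_n}, #|V| = 4%N /\
    G = [set e : edge | ((val e).1 \in V) && ((val e).2 \in V)].

Fixpoint resultant_tree (t : rtree) : Prop :=
  match t with
  | RLeaf G => isK4 G
  | RNode G e l r =>
      resultant_tree l /\ resultant_tree r /\ rroot l != rroot r /\
      e \in rroot l /\ e \in rroot r /\ G = CR (rroot l) (rroot r) e /\
      rigidity_circuit G
  end.

Fixpoint obtained (t : rtree) (q : Xpoly) : Prop :=
  match t with
  | RLeaf G => circuit_poly G q
  | RNode G e l r =>
      exists ql qr, obtained l ql /\ obtained r qr /\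
        irreducibleMP q /\ inCM q /\ dvdMP q (Res ql qr e)
  end.

End CM.

(* Main.v *)
(** The ring map phi sending x_ij to (a_i - a_j)(b_i - b_j) kills CM_n, because the bordered matrix
    then has rank at most 4.  Conversely ker phi is contained in CM_n: modulo CM_n the Gram matrix
    s_ij seen from a base point is symmetric with vanishing 3 x 3 minors, and adjoining elements
    d_ij with d_ij d_kl equal to minus a 2 x 2 minor of s makes the z_ij = (s_ij + d_ij) / 2 satisfy
    the relations of the products a_i b_j; so a polynomial that vanishes in the a_i, b_j already
    vanishes modulo CM_n.  In particular CM_n is prime.

    If C is a rigidity circuit and c an edge of it, then C \ c is sparse, so by Laman's theorem
    (Henneberg induction on stress-free frameworks) its lengths are algebraically independent and
    CM_n contains no nonzero polynomial in Q[C \ c].  If f lies in CM_n and in Q[C], the resultant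
    of p_C and f with respect to x_c lies in CM_n and in Q[C \ c], hence is zero; as Q[X_n] is
    factorial and p_C is irreducible, p_C divides f.  The same criterion shows that Res(p_A, p_B, x_e)
    is nonzero, since p_A and p_B are irreducible with different supports.  Primality of CM_n then
    yields an irreducible factor in CM_n at each node of a resultant tree, and for K_4 a factor of the
    5 x 5 minor of the four points. *)
Require Import Defs.
From HB Require Import structures.
From mathcomp Require Import all_boot all_order all_fingroup all_algebra.
From mathcomp Require Import ring_quotient generic_quotient mpoly ring zify.
From Stdlib Require Import Classical ClassicalEpsilon.
Set Implicit Arguments.
Unset Strict Implicit.
Unset Printing Implicit Defensive.
Import Order.TTheory GRing.Theory Num.Theory.
Local Open Scope ring_scope.

(** * Unique factorization in polynomial rings *)

(** The two inclusions between CM_n and ker phi serve different ends. That CM_n lies in ker phi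
    turns membership into vanishing on all frameworks, on which independence, and with it
    divisibility by p_C, relies. The converse certifies that a factor killed by phi really is a
    combination of minors, so that every node of a resultant tree has a factor to select. For the
    converse, adjoining the d_ij as ring elements would leave open whether the quotient ring still
    embeds in the extension. The extension is therefore replaced by operators z_ij on a module of
    pairs whose first component is the quotient ring: a relation among the z_ij, applied to (1, 0),
    is read off in that component. The operators are shown to commute on pairs whose odd part
    satisfies the linear relations of the d_ij, an invariant that has to be carried along. A
    vanishing resultant yields an identity V q = W p; to conclude that p divides q, the irreducible
    p has to be prime, hence the development of unique factorization. *)

Section Divisibility.
Variable R : idomainType.
Implicit Types a b c p q : R.

Definition divides a b := exists q, b = q * a.

Definition irreducible_elt p :=
  p != 0 /\ p \isn't a GRing.unit /\
  forall a b, p = a * b -> a \is a GRing.unit \/ b \is a GRing.unit.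

Definition prime_elt p :=
  [/\ p != 0, p \isn't a GRing.unit &
   forall a b, divides p (a * b) -> divides p a \/ divides p b].

(** The factors are prime rather than merely irreducible, so uniqueness of the factorization need
    not be part of the definition. *)
Definition factorial_ring := forall c, c != 0 ->
  exists u (s : seq R), [/\ u \is a GRing.unit,
    (forall p, p \in s -> prime_elt p) & c = u * \prod_(p <- s) p].

Lemma divides_refl a : divides a a.
Proof. by exists 1; rewrite mul1r. Qed.

Lemma divides_mull a b c : divides a b -> divides a (c * b).
Proof. by case=> q ->; exists (c * q); rewrite mulrA. Qed.

Lemma divides_unitM u p a : u \is a GRing.unit ->
  divides (u * p) a <-> divides p a.
Proof.
move=> Uu; split=> -[q ->]; first by exists (q * u); rewrite mulrA.
by exists (q * u^-1); rewrite mulrA divrK.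
Qed.

Lemma prime_unitM u p : u \is a GRing.unit -> prime_elt p -> prime_elt (u * p).
Proof.
move=> Uu [p0 nUp Pp]; split.
- by rewrite mulf_neq0 //; apply: contraTneq Uu => ->; rewrite unitr0.
- by rewrite unitrMr.
by move=> a b /(divides_unitM _ _ Uu)/Pp [] H; [left|right]; apply/divides_unitM.
Qed.

Lemma factorial_irreducible_prime p :
  factorial_ring -> irreducible_elt p -> prime_elt p.
Proof.
move=> fR [p0 [nUp irr_p]]; have [u [s [Uu Ps def_p]]] := fR p p0.
case: s Ps def_p => [|pi s] Ps def_p.
  by rewrite def_p big_nil mulr1 Uu in nUp.
have Ppi : prime_elt pi by apply: Ps; rewrite mem_head.
have def_p' : p = (u * \prod_(j <- s) j) * pi.
  by rewrite def_p big_cons mulrA mulrAC.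
have [U|] := irr_p _ _ def_p'; first by rewrite def_p'; apply: prime_unitM.
by case: Ppi => _ /negPf->.
Qed.

Lemma irreducible_divides_associate p q :
  irreducible_elt p -> irreducible_elt q -> divides p q ->
  exists2 u, u \is a GRing.unit & q = u * p.
Proof.
move=> [_ [nUp _]] [_ [_ irr_q]] [u def_q]; exists u => //.
by have [//|] := irr_q _ _ def_q; rewrite (negPf nUp).
Qed.


End Divisibility.

Section GaussLemma.
Variable R : idomainType.
Implicit Types f g p q d : {poly R}.

(* Peel leading terms: c divides lc f * lc g, hence one of the two leading terms. *)
Lemma prime_polyC (c : R) : prime_elt c -> prime_elt c%:P.
Proof.
move=> [c0 nUc Pc]; split; first by rewrite polyC_eq0.
  by rewrite poly_unitE size_polyC c0 coefC eqxx.
move=> f g; have [k] := ubnP (size f + size g).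
elim: k => // k IHk in f g *; rewrite ltnS => le_k dvd_fg.
have [->|f0] := eqVneq f 0; first by left; exists 0; rewrite mul0r.
have [->|g0] := eqVneq g 0; first by right; exists 0; rewrite mul0r.
pose drop_lead (h : {poly R}) := h - (lead_coef h)%:P * 'X^((size h).-1).
have drop_leadE h : h = drop_lead h + (lead_coef h)%:P * 'X^((size h).-1).
  by rewrite subrK.
have size_drop h : h != 0 -> (size (drop_lead h) < size h)%N.
  move=> h0; rewrite (polySpred h0) ltnS; apply/leq_sizeP => j le_j.
  rewrite coefB coefCM coefXn; case: eqVneq => [->|ne_j].
    by rewrite mulr1 lead_coefE subrr.
  rewrite mulr0 subr0 nth_default //.
  by rewrite (polySpred h0) ltn_neqAle eq_sym ne_j.
have dvd_lead h : divides c (lead_coef h) ->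
    divides c%:P ((lead_coef h)%:P * 'X^((size h).-1)).
  by case=> q ->; exists (q%:P * 'X^((size h).-1)); rewrite polyCM mulrAC.
have dvdD h1 h2 : divides c%:P h1 -> divides c%:P h2 -> divides c%:P (h1 + h2).
  by move=> [q1 ->] [q2 ->]; exists (q1 + q2); rewrite mulrDl.
have dvdN h1 : divides c%:P h1 -> divides c%:P (- h1).
  by move=> [q1 ->]; exists (- q1); rewrite mulNr.
have : divides c (lead_coef f * lead_coef g).
  case: dvd_fg => q def_fg; exists (lead_coef q).
  by rewrite -lead_coefM def_fg lead_coefM lead_coefC.
case/Pc => /dvd_lead dvdl.
- have [||dvdf|] := IHk (drop_lead f) g; last by right.
  + by apply: leq_trans le_k; rewrite ltn_add2r size_drop.
  + rewrite mulrBl; apply: dvdD => //; apply: dvdN.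
    by rewrite mulrC; apply: divides_mull.
  by left; rewrite (drop_leadE f); apply: dvdD.
- have [||| dvdg] := IHk f (drop_lead g); last 2 first.
  + by left.
  + by right; rewrite (drop_leadE g); apply: dvdD.
  + by apply: leq_trans le_k; rewrite ltn_add2l size_drop.
  rewrite mulrBr; apply: dvdD => //; apply: dvdN.
  exact: divides_mull.
Qed.

Hypothesis factR : factorial_ring R.

(* A constant can be cancelled from both sides one prime at a time, since primes of R stay prime
   in R[X]; this replaces the passage to the field of fractions in Gauss's lemma. *)
Lemma factor_scaled (c : R) p q d : c != 0 -> c%:P * p = q * d ->
  exists q' d' (a b : R),
    [/\ p = q' * d', q = a%:P * q', d = b%:P * d' & b != 0].
Proof.
case/factR=> u [s [Uu Ps ->]].
elim: s Ps p q d => [|pi s IHs] Ps p q d.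
  rewrite big_nil mulr1 => def_up; exists (u^-1%:P * q), d, u, 1.
  rewrite -mulrA -def_up !mulrA -!polyCM mulVr // mulrV // !mul1r.
  by split=> //; apply: oner_neq0.
rewrite big_cons mulrCA polyCM -mulrA => def_pip.
have Ppi : prime_elt pi by apply: Ps; rewrite mem_head.
have [piP0 _ PpiP] := prime_polyC Ppi.
have {}IHs := IHs (fun x xs => Ps x (mem_behead (s := pi :: s) xs)).
have [|[q1 def_q]|[d1 def_d]] := PpiP q d.
- by exists ((u * \prod_(j <- s) j)%:P * p); rewrite -def_pip mulrC.
- have /IHs[q' [d' [a [b [-> def_q1 -> b0]]]]] :
      (u * \prod_(j <- s) j)%:P * p = q1 * d.
    by apply: (mulfI piP0); rewrite def_pip def_q; ring.
  by exists q', d', (a * pi), b; rewrite def_q def_q1 polyCM; split=> //; ring.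
- have /IHs[q' [d' [a [b [-> -> def_d1 b0]]]]] :
      (u * \prod_(j <- s) j)%:P * p = q * d1.
    by apply: (mulfI piP0); rewrite def_pip def_d; ring.
  exists q', d', a, (b * pi); rewrite def_d def_d1 polyCM; split=> //; first by ring.
  by rewrite mulf_neq0 //; case: Ppi.
Qed.

(** [factor_scaled] moves the constant c into the factors and leaves p = b * d'. As p is irreducible
    and not constant, b is a unit and can be inverted. *)
Lemma divides_scaled (c : R) p f : irreducible_elt p -> (1 < size p)%N -> c != 0 ->
  divides p (c%:P * f) -> divides p f.
Proof.
move=> [_ [_ irr_p]] p_nc c0 [q /(factor_scaled c0)].
case=> q' [d' [a [b [-> _ def_p b0]]]]; exists (b^-1%:P * q').
have [|] := irr_p _ _ def_p.
  rewrite poly_unitE coefC eqxx => /andP[_ Ub].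
  by rewrite def_p mulrACA -polyCM mulVr // mul1r.
rewrite poly_unitE => /andP[/eqP size_d' _].
have := size_polyMleq b%:P d'; rewrite -def_p size_d' size_polyC b0 /= => le_p.
by rewrite ltnNge le_p in p_nc.
Qed.

Lemma irreducible_polyC (c : R) : irreducible_elt c%:P -> irreducible_elt c.
Proof.
have unitC (x : R) : (x%:P \is a GRing.unit) = (x \is a GRing.unit).
  rewrite poly_unitE coefC eqxx size_polyC.
  by case: (eqVneq x 0) => [->|_]; rewrite ?unitr0.
move=> [c0 [nUc irr_c]]; split; first by rewrite -polyC_eq0.
split; first by rewrite -unitC.
by move=> a b def_c; rewrite -!unitC; apply: irr_c; rewrite def_c polyCM.
Qed.

(** The gcd d of p and f and its Bezout identity live over the field of fractions; pseudo-division
    gives them up to nonzero constants. Irreducibility leaves two cases: d is p up to constants, so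
    p divides a constant times f, or d is constant and Bezout's identity times g shows that p
    divides a constant times g. [divides_scaled] removes the constants. *)
Theorem irreducible_prime_poly p : irreducible_elt p -> prime_elt p.
Proof.
move=> Ip; have [p0 [nUp irr_p]] := Ip.
have [p_nc|p_c] := ltnP 1 (size p); last first.
  rewrite (size1_polyC p_c) in Ip *; apply: prime_polyC.
  exact/factorial_irreducible_prime/irreducible_polyC.
split=> // f g dvd_fg.
have /Pdiv.Idomain.dvdpP[[c1 q1] /= c1_0] := Pdiv.Idomain.dvdp_gcdl p f.
have /Pdiv.Idomain.dvdpP[[c2 q2] /= c2_0] := Pdiv.Idomain.dvdp_gcdr p f.
have [[u v] /= /Pdiv.Idomain.eqpP[[a b] /andP[/= a0 b0]]] := Pdiv.Idomain.Bezoutp p f.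
move: (gcdp p f) => d; rewrite -!mul_polyC => def_d def_f def_p.
have [q' [d' [_ [e [def_p' _ def_d' e0]]]]] := factor_scaled c1_0 def_p.
have [Uq'|] := irr_p _ _ def_p'; last rewrite poly_unitE => /andP[/eqP size_d' _].
  left; apply: (divides_scaled Ip p_nc c2_0); exists (q2 * e%:P * q'^-1).
  by rewrite def_f def_d' def_p' -!mulrA mulKr.
right.
have [m m0 def_d2] : exists2 m, m != 0 & d = m%:P.
  have /size_poly1P[m m0 def_m] : size d' == 1 by rewrite size_d'.
  by exists (e * m); rewrite ?mulf_neq0 // def_d' def_m polyCM.
apply: (@divides_scaled (b * m) _ _ Ip p_nc); first by rewrite mulf_neq0.
have -> : (b * m)%:P * g = (a%:P * u * g) * p + (a%:P * v) * (f * g).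
  rewrite polyCM -def_d2 -def_d; ring.
case: dvd_fg => q ->; exists (a%:P * u * g + a%:P * v * q); ring.
Qed.

End GaussLemma.

Lemma isomorphic_irreducible_prime (R S : idomainType) (f : {rmorphism R -> S})
    (g : S -> R) : cancel f g -> cancel g f ->
  (forall p : S, irreducible_elt p -> prime_elt p) ->
  forall p : R, irreducible_elt p -> prime_elt p.
Proof.
move=> fK gK irrS p [p0 [nUp irr_p]].
have f_inj := can_inj fK.
have unit_f x : (f x \is a GRing.unit) = (x \is a GRing.unit).
  apply/idP/idP => [/unitrP[y [yx _]]|]; last exact: rmorph_unit.
  apply/unitrP; exists (g y); rewrite mulrC; split; apply: f_inj;
  by rewrite ?rmorphM ?rmorph1 gK // mulrC.
have [|_ _ Pfp] := irrS (f p).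
  split; first by rewrite -(rmorph0 f) (inj_eq f_inj).
  split; first by rewrite unit_f.
  move=> a b def_p; rewrite -(gK a) -(gK b) !unit_f; apply: irr_p.
  by apply: f_inj; rewrite rmorphM !gK.
split=> // a b [q def_ab].
have [|[r def]|[r def]] := Pfp (f a) (f b).
- by exists (f q); rewrite -!rmorphM def_ab.
- by left; exists (g r); apply: f_inj; rewrite rmorphM gK.
- by right; exists (g r); apply: f_inj; rewrite rmorphM gK.
Qed.

Lemma mpoly_rmorph_eq n (R : nzRingType) (S : nzRingType)
    (f g : {rmorphism {mpoly R[n]} -> S}) :
  (forall c, f c%:MP = g c%:MP) -> (forall i, f 'X_i = g 'X_i) -> f =1 g.
Proof.
move=> fgC fgX p; elim/mpolyind: p => [|c m p _ _ IHp]; first by rewrite !rmorph0.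
rewrite !rmorphD IHp -mul_mpolyC !rmorphM fgC mpolyXE_id !rmorph_prod; congr (_ * _ + _).
by apply: eq_bigr => i _; rewrite !rmorphXn fgX.
Qed.

Section MpolyFactorial.
Variable F : fieldType.

Let toX n (i : 'I_n.+1) : {poly {mpoly F[n]}} :=
  if unlift ord_max i is Some j then ('X_j)%:P else 'X.

Let to n : {rmorphism {mpoly F[n.+1]} -> {poly {mpoly F[n]}}} :=
  mmap (polyC \o @mpolyC n F) (@toX n).

Let ofC n : {rmorphism {mpoly F[n]} -> {mpoly F[n.+1]}} :=
  mmap (@mpolyC n.+1 F) (fun j => 'X_(lift ord_max j)).

Let from n : {rmorphism {poly {mpoly F[n]}} -> {mpoly F[n.+1]}} :=
  horner_eval ('X_ord_max) \o map_poly (ofC n).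

Let toK n : cancel (to n) (from n).
Proof.
move=> p; rewrite -[LHS]/((from n \o to n) p) -[RHS]/(idfun p).
apply: (mpoly_rmorph_eq (f := from n \o to n) (g := idfun)) => [c|i] /=.
  by rewrite mmapC /= /horner_eval map_polyC hornerC /= mmapC.
rewrite mmapX mmap1U /toX; case: unliftP => [j ->|->].
  by rewrite /horner_eval map_polyC hornerC /= mmapX mmap1U.
by rewrite /horner_eval map_polyX hornerX.
Qed.

Let to_ofC n (c : {mpoly F[n]}) : to n (ofC n c) = c%:P.
Proof.
apply: (mpoly_rmorph_eq (f := to n \o ofC n) (g := polyC)) => [a|i] /=.
  by rewrite !mmapC.
by rewrite mmapX mmap1U mmapX mmap1U /toX /= liftK.
Qed.

Let fromK n : cancel (from n) (to n).
Proof.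
elim/poly_ind => [|p c IHp]; first by rewrite !rmorph0.
rewrite !rmorphD !rmorphM IHp /= /horner_eval map_polyX hornerX map_polyC hornerC to_ofC.
by rewrite mmapX mmap1U /toX unlift_none.
Qed.

(** Splitting terminates because [msize] strictly drops when both factors are nonunits. Together
    with [irreducible_prime_poly] this closes the induction on the number of variables. *)
Lemma mpoly_factorization n :
  (forall p : {mpoly F[n]}, irreducible_elt p -> prime_elt p) ->
  factorial_ring {mpoly F[n]}.
Proof.
move=> irrP c; have [k] := ubnP (msize c); elim: k => // k IHk in c *.
rewrite ltnS => le_k c0.
have [Uc|nUc] := boolP (c \is a GRing.unit).
  by exists c, [::]; split=> //; rewrite big_nil mulr1.
have [Ic|nIc] := classic (irreducible_elt c).
  exists 1, [:: c]; split; rewrite ?unitr1 ?big_seq1 ?mul1r // => p.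
  by rewrite inE => /eqP->; apply: irrP.
have [a [b [def_c nUa nUb]]] : exists a b, [/\ c = a * b, a \isn't a GRing.unit &
    b \isn't a GRing.unit].
  apply: NNPP => no_ab; apply: nIc; split=> //; split=> // a b def_c.
  apply: NNPP => /not_or_and[/negP nUa /negP nUb]; apply: no_ab.
  by exists a, b.
have := c0; rewrite def_c mulf_eq0 negb_or => /andP[a0 b0].
have size_nonunit (x : {mpoly F[n]}) : x != 0 -> x \isn't a GRing.unit -> (1 < msize x)%N.
  move=> x0 nUx; rewrite ltnNge; apply: contra nUx => le1.
  have def_x := msize1_polyC le1; rewrite def_x rmorph_unit // unitfE.
  by apply: contraNneq x0 => x00; rewrite def_x x00 mpolyC0.
have := size_nonunit a a0 nUa; have := size_nonunit b b0 nUb.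
move=> b1 a1; move: le_k; rewrite def_c msizeM // => le_k.
have [lt_a lt_b] : (msize a < k)%N /\ (msize b < k)%N.
  by move: le_k a1 b1; move: (msize a) (msize b) => x y; lia.
have [u [s [Uu Ps def_a]]] := IHk a lt_a a0.
have [v [t [Uv Pt def_b]]] := IHk b lt_b b0.
exists (u * v), (s ++ t); split; first by rewrite unitrM Uu.
  by move=> p; rewrite mem_cat => /orP[/Ps|/Pt].
by rewrite big_cat def_a def_b /=; ring.
Qed.

Theorem mpoly_irreducible_prime n (p : {mpoly F[n]}) : irreducible_elt p -> prime_elt p.
Proof.
elim: n p => [|n IHn].
  move=> p [p0 [/negP nUp _]]; case: nUp; rewrite -(mpolyKC p) rmorph_unit // unitfE.
  by apply: contraNneq p0 => p00; rewrite -(mpolyKC p) p00 mpolyC0.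
apply: (isomorphic_irreducible_prime (@toK n) (@fromK n)).
exact/irreducible_prime_poly/mpoly_factorization.
Qed.

Corollary mpoly_factorial n : factorial_ring {mpoly F[n]}.
Proof. exact/mpoly_factorization/mpoly_irreducible_prime. Qed.

End MpolyFactorial.

(** * Resultants with respect to one variable *)

(** The shape of the Sylvester matrix depends on the sizes of p and q, which f preserves when it
    does not kill the leading coefficients. *)
Lemma resultant_map (A B : nzRingType) (f : {rmorphism A -> B}) (p q : {poly A}) :
    f (lead_coef p) != 0 -> f (lead_coef q) != 0 ->
  f (resultant p q) = resultant (map_poly f p) (map_poly f q).
Proof.
move=> nz_fp nz_fq; rewrite -det_map_mx /resultant.
have eq_sz (r : {poly A}) : f (lead_coef r) != 0 -> size (map_poly f r) = size r.
  exact: size_map_poly_id0.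
rewrite /Sylvester_mx !eq_sz // map_col_mx; congr (\det (col_mx _ _));
  by apply: map_lin1_mx => v; rewrite map_poly_rV rmorphM /= map_rVpoly.
Qed.

Lemma resultant_fixed (A : nzRingType) (f : {rmorphism A -> A}) (p q : {poly A}) :
    (1 < size p)%N -> (1 < size q)%N -> map_poly f p = p -> map_poly f q = q ->
  f (resultant p q) = resultant p q.
Proof.
have nz_lead (r : {poly A}) : (1 < size r)%N -> map_poly f r = r -> f (lead_coef r) != 0.
  move=> r_nc def_r; rewrite lead_coefE -coef_map def_r -lead_coefE lead_coef_eq0.
  by rewrite -size_poly_gt0 ltnW.
move=> p_nc q_nc fp fq.
by rewrite resultant_map ?nz_lead // fp fq.
Qed.

(** V and W are p and q divided by their gcd, up to constants; the gcd has positive degree, whence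
    the strict bound on V. *)
Lemma resultant_eq0_cofactors (A : idomainType) (p q : {poly A}) :
    p != 0 -> resultant p q = 0 ->
  exists V W : {poly A}, [/\ V != 0, (size V < size p)%N & V * q = W * p].
Proof.
move=> p0 /eqP; rewrite resultant_eq0.
have /Pdiv.Idomain.dvdpP[[c1 q1] /= c1_0] := Pdiv.Idomain.dvdp_gcdl p q.
have /Pdiv.Idomain.dvdpP[[c2 q2] /= c2_0] := Pdiv.Idomain.dvdp_gcdr p q.
move: (gcdp _ _) => d def_q def_p d_nc.
have d0 : d != 0 by rewrite -size_poly_gt0 ltnW.
have q1_0 : q1 != 0.
  apply: contraNneq p0 => q10; move: def_p; rewrite q10 mul0r => /eqP.
  by rewrite scale_poly_eq0 (negPf c1_0).
exists (c2 *: q1), (c1 *: q2); split.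
- by rewrite scale_poly_eq0 (negPf c2_0).
- rewrite size_scale // -(size_scale p c1_0) def_p size_mul //.
  by move: d_nc; case: (size d) => [|[|k]] // _; rewrite addnS /= addnS ltnS leq_addr.
- by rewrite -!scalerAl !scalerAr def_p def_q; ring.
Qed.

(** Meant for a map k that extracts a coefficient: not multiplicative, but linear over the
    coefficients of q. *)
Lemma map_poly_semilinear (A : nzRingType) (k : A -> A) (p q : {poly A}) :
    {morph k : x y / x + y} -> k 0 = 0 -> (forall x l, k (x * q`_l) = k x * q`_l) ->
  map_poly k (p * q) = map_poly k p * q.
Proof.
move=> kD k0 kM; apply/polyP => l.
rewrite coef_map_id0 // !coefM (big_morph k kD k0); apply: eq_bigr => j _.
by rewrite coef_map_id0 // kM.
Qed.

Lemma leq_size_mull (A : idomainType) (p q : {poly A}) :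
  q != 0 -> (size p <= size (q * p)%R)%N.
Proof.
move=> q0; have [->|p0] := eqVneq p 0; first by rewrite size_poly0.
by rewrite size_mul // (polySpred q0) addSn leq_addl.
Qed.

Section Variables.
Variables (F : fieldType) (N : nat).
Local Notation P := {mpoly F[N]}.
Implicit Types (p q : P) (i j : 'I_N) (S : {set 'I_N}).

Definition vars p : {set 'I_N} := [set i | has (fun m : 'X_{1..N} => (0 < m i)%N) (msupp p)].

(* [keep S] kills the variables outside S, so that membership in F[S] becomes being fixed by a
   ring morphism. *)
Definition keepX S i : P := if i \in S then 'X_i else 0.

Definition keep S : {rmorphism P -> P} := mmap (@mpolyC _ F) (keepX S).

Definition monom_in S (m : 'X_{1..N}) := [forall i, (0 < m i)%N ==> (i \in S)].

Lemma keepC S a : keep S a%:MP = a%:MP. Proof. exact: mmapC. Qed.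
Lemma keepXU S i : keep S 'X_i = keepX S i. Proof. by rewrite [LHS]mmapX mmap1U. Qed.

Lemma keep_monom S m : keep S 'X_[m] = if monom_in S m then 'X_[m] else 0.
Proof.
rewrite [LHS]mmapX /mmap1; case: ifP => [/forallP in_m|/forallPn[i]].
  rewrite [RHS]mpolyXE_id; apply: eq_bigr => i _; rewrite /keepX.
  by case: (posnP (m i)) (in_m i) => [-> _|mi_gt0 /= -> //].
rewrite negb_imply => /andP[mi_gt0 /negPf iS].
by rewrite (bigD1 i) //= /keepX iS expr0n -(negbK (m i == 0)%N) -lt0n mi_gt0 mul0r.
Qed.

Opaque keep.

Lemma mcoeff_keep S p m : (keep S p)@_m = if monom_in S m then p@_m else 0.
Proof.
rewrite {1}(mpolyE p) rmorph_sum raddf_sum /=.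
transitivity (\sum_(m' <- msupp p) (if monom_in S m then p@_m' * (m' == m)%:R else 0)).
  apply: eq_bigr => m' _; rewrite -mul_mpolyC rmorphM keepC.
  rewrite keep_monom mul_mpolyC mcoeffZ; case: (eqVneq m' m) => [->|ne].
    by case: ifP; rewrite ?mcoeff0 ?mulr0 // mcoeffX eqxx.
  by rewrite mulr0 if_same; case: ifP; rewrite ?mcoeff0 ?mulr0 // mcoeffX (negPf ne) mulr0.
case: ifP => _; last by rewrite big1.
rewrite [in RHS](mpolyE p) raddf_sum /=.
by apply: eq_bigr => m' _; rewrite mcoeffZ mcoeffX.
Qed.

Lemma vars_keep S p : (vars p \subset S) = (keep S p == p).
Proof.
apply/subsetP/eqP => [sub|<- i].
  apply/mpolyP => m; rewrite mcoeff_keep; case: ifP => // /forallPn[i].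
  rewrite negb_imply => /andP[mi iS]; case: (boolP (m \in msupp p)) => [mp|].
    by case/negP: iS; apply: sub; rewrite inE; apply/hasP; exists m.
  by rewrite mcoeff_msupp negbK => /eqP.
rewrite inE => /hasP[m]; rewrite mcoeff_msupp mcoeff_keep.
by case: ifP => [/forallP/(_ i)/implyP H _ /H|]; last by rewrite eqxx.
Qed.

Definition univX i j : {poly P} := if j == i then 'X else ('X_j)%:P.

(** The coefficients stay in the full ring P, so evaluation at ['X_i] gives p back and univariate
    identities return to P. *)
Definition univm i : {rmorphism P -> {poly P}} := mmap (polyC \o @mpolyC _ F) (univX i).

Lemma univC i a : univm i a%:MP = a%:MP%:P. Proof. exact: mmapC. Qed.
Lemma univXU i j : univm i 'X_j = univX i j. Proof. by rewrite [LHS]mmapX mmap1U. Qed.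

Opaque univm.

Lemma univK i p : (univm i p).['X_i] = p.
Proof.
apply: (mpoly_rmorph_eq (f := horner_eval 'X_i \o univm i) (g := idfun)) => [a|j].
  by rewrite /= univC /horner_eval hornerC.
rewrite /= univXU /univX /horner_eval.
by case: eqVneq => [->|_]; rewrite ?hornerX ?hornerC.
Qed.

Lemma univ_keep i S p : map_poly (keep (S :\ i)) (univm i p) = univm i (keep (i |: S) p).
Proof.
apply: (mpoly_rmorph_eq (f := map_poly (keep (S :\ i)) \o univm i)
  (g := univm i \o keep (i |: S))) => [a|j].
  by rewrite /= keepC !univC map_polyC /= keepC.
rewrite /= keepXU !univXU /univX /keepX !inE.
case: (eqVneq j i) => [->|ne].
  by rewrite map_polyX univXU /univX eqxx.
rewrite map_polyC /= keepXU /keepX !inE ne /=.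
by case: ifP => _; rewrite ?rmorph0 // univXU /univX (negPf ne).
Qed.

Lemma univ_vars i S p : vars p \subset i |: S ->
  map_poly (keep (S :\ i)) (univm i p) = univm i p.
Proof. by rewrite vars_keep univ_keep => /eqP->. Qed.

Lemma univ_free i p : i \notin vars p -> univm i p = p%:P.
Proof.
move=> ip; have def_p : keep (~: [set i]) p = p.
  apply/eqP; rewrite -vars_keep; apply/subsetP => j jp.
  by rewrite !inE; apply: contraNneq ip => <-.
rewrite -{1}def_p -[in RHS]def_p; move: p {ip def_p}; apply: (@mpoly_rmorph_eq _ _ _
  (univm i \o keep (~: [set i])) (polyC \o keep (~: [set i]))) => [a|j]; rewrite /=.
  by rewrite keepC univC.
rewrite keepXU /keepX !inE; case: eqVneq => [_|ne]; first by rewrite !rmorph0.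
by rewrite univXU /univX (negPf ne).
Qed.

Lemma univ_coef_free i p k : univm i (univm i p)`_k = ((univm i p)`_k)%:P.
Proof.
apply: univ_free.
have := @univ_vars i setT p; rewrite setUT subsetT => /(_ isT) /polyP/(_ k).
rewrite coef_map => /eqP; rewrite -vars_keep => /subsetP sub.
by apply/negP => /sub; rewrite !inE eqxx.
Qed.

Lemma univ_size i p : i \in vars p -> (1 < size (univm i p))%N.
Proof.
move=> ip; rewrite ltnNge; apply/negP => /size1_polyC def_p.
have def_c := univK i p; rewrite def_p hornerC in def_c.
have := @univ_vars i setT p; rewrite setUT subsetT => /(_ isT).
rewrite def_p map_polyC def_c /= => /polyC_inj /eqP.
rewrite -vars_keep.
by move/subsetP/(_ i ip); rewrite !inE eqxx.
Qed.

Definition res i p q := resultant (univm i p) (univm i q).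

Lemma res_ideal p q i : i \in vars p -> i \in vars q ->
  exists u v, res i p q = u * p + v * q.
Proof.
move=> /univ_size size_p /univ_size size_q.
have [[u v] /= _ def_r] := resultant_in_ideal size_p size_q.
exists u.['X_i], v.['X_i].
by rewrite -{2}(univK i p) -{2}(univK i q) -!hornerM -hornerD -def_r hornerC.
Qed.

Lemma vars_res p q i S : i \in vars p -> i \in vars q ->
  vars p \subset i |: S -> vars q \subset i |: S -> vars (res i p q) \subset S :\ i.
Proof.
move=> /univ_size p_nc /univ_size q_nc /univ_vars Sp /univ_vars Sq.
rewrite vars_keep; apply/eqP; exact: (resultant_fixed p_nc q_nc Sp Sq).
Qed.

(** From V q = W p with V of smaller degree, the prime p divides V or q, and a degree count in
    ['X_i] excludes V. *)
Lemma res_eq0_divides p q i : irreducible_elt p -> i \in vars p ->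
  res i p q = 0 -> divides p q.
Proof.
move=> Ip ip res0.
have Up0 : univm i p != 0 by rewrite -size_poly_gt0 ltnW // univ_size.
have [V [W [V0 V_lt VW]]] : exists V W : {poly P},
    [/\ V != 0, (size V < size (univm i p))%N & V * univm i q = W * univm i p].
  exact: resultant_eq0_cofactors.
(* The cofactors may still involve 'X_i in their coefficients; extracting from these the
   coefficient of a suitable power of 'X_i is linear over the polynomials without 'X_i. *)
have [k Vk0] : exists k, V`_k != 0.
  by exists (size V).-1; rewrite -lead_coefE lead_coef_eq0.
have [r Vkr0] : exists r, (univm i V`_k)`_r != 0.
  exists (size (univm i V`_k)).-1; rewrite -lead_coefE lead_coef_eq0.
  by apply: contraNneq Vk0 => Vk0; rewrite -(univK i V`_k) Vk0 horner0.
pose kappa (c : P) := (univm i c)`_r.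
have kappaD : {morph kappa : x y / x + y} by move=> x y; rewrite /kappa rmorphD coefD.
have kappa0 : kappa 0 = 0 by rewrite /kappa rmorph0 coef0.
have kappaM x (s : P) l : kappa (x * (univm i s)`_l) = kappa x * (univm i s)`_l.
  by rewrite /kappa rmorphM univ_coef_free coefMC.
have kappaV : kappa V`_k != 0 by [].
have kappa_free c : univm i (kappa c) = (kappa c)%:P by apply: univ_coef_free.
clearbody kappa.
pose lift := map_poly kappa.
have VW' : lift V * univm i q = lift W * univm i p.
  have liftM (T : {poly P}) (s : P) : lift (T * univm i s) = lift T * univm i s.
    by apply: (map_poly_semilinear _ kappaD kappa0) => x l; apply: kappaM.
  by rewrite -(liftM V q) -(liftM W p) VW.
have liftE (T : {poly P}) l : (lift T)`_l = kappa T`_l by apply: coef_map_id0.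
(* The coefficients of [lift V] are now free of ['X_i], so substituting ['X_i] for the indeterminate
   loses nothing and v keeps the small degree of V. *)
pose v := (lift V).['X_i].
have Uv : univm i v = lift V.
  rewrite /v horner_coef rmorph_sum -[RHS]coefK poly_def; apply: eq_bigr => l _.
  rewrite rmorphM rmorphXn univXU /univX eqxx -mul_polyC; congr (_ * _).
  by rewrite liftE kappa_free.
have v0 : v != 0.
  apply: contraNneq kappaV => v0.
  by rewrite -liftE -Uv v0 rmorph0 coef0.
have [_ _ Pp] := mpoly_irreducible_prime Ip.
have [|[t def_v]|//] := Pp v q.
  by exists (lift W).['X_i]; rewrite -{1}(univK i q) -hornerM VW' hornerM univK.
have : (size (univm i v) < size (univm i p))%N.
  by rewrite Uv; apply: leq_ltn_trans V_lt; apply: size_poly.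
have t0 : univm i t != 0.
  by apply: contraNneq v0 => t0; rewrite def_v -(univK i (t * p)) rmorphM t0 mul0r horner0.
by rewrite def_v rmorphM ltnNge (leq_size_mull (univm i p) t0).
Qed.

End Variables.

(** * The quotient by the 3 x 3 minors of a symmetric matrix *)

Section RankTwo.
Variables (R : comNzRingType) (n : nat) (s : 'I_n -> 'I_n -> R) (h : R).
Hypothesis sC : forall i j, s i j = s j i.
Hypothesis hh : h + h = 1.

(* If s i j = a i * b j + a j * b i, then cminor i j k l = d i j * d k l for
   d i j = a i * b j - a j * b i. *)
Definition cminor i j k l := s i l * s j k - s i k * s j l.

Lemma cminorC i j k l : cminor i j k l = cminor k l i j.
Proof. by rewrite /cminor (sC i) (sC j) (sC i) (sC j); ring. Qed.

(** Up to sign, the 3 x 3 minor with rows a, b, c and columns x, p, q, expanded along column x. *)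
Hypothesis s3 : forall x a b c p q,
  s x a * cminor b c p q - s x b * cminor a c p q + s x c * cminor a b p q = 0.

Local Notation V := (R^o * 'M[R]_n)%type.
Implicit Types (v : 'M[R]_n) (t : V).

(** The linear relations of the d i j: antisymmetry, and the relation expressing that three vectors
    of a plane are dependent. *)
Definition odd_part v := (forall a b, v a b = - v b a) /\
  (forall x a b c, s x a * v b c - s x b * v a c + s x c * v a b = 0).

(** Both sides stand for v * d k l * d p q * d r u, with different pairs of d's contracted to a
    [cminor]. The difference is a combination of four instances of the three-term relation. *)
Lemma odd_part_exchange v k l p q r u : odd_part v ->
  v k l * cminor p q r u = v p q * cminor k l r u.
Proof.
move=> [_ vT]; rewrite /cminor.
have T1 := vT r q k l; have T2 := vT u p q l.
have T3 := vT u p q k; have T4 := vT r p k l.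
rewrite ![s _ r]sC ![s _ u]sC.
apply/eqP; rewrite -subr_eq0; apply/eqP.
transitivity (s u p * (s r q * v k l - s r k * v q l + s r l * v q k) +
  s r k * (s u p * v q l - s u q * v p l + s u l * v p q) -
  s r l * (s u p * v q k - s u q * v p k + s u k * v p q) -
  s u q * (s r p * v k l - s r k * v p l + s r l * v p k)).
  by ring.
by rewrite T1 T2 T3 T4 !mulr0 addr0 !subr0.
Qed.

(* The action of z i j = (s i j + d i j) / 2, standing for a i * b j, on R (+) sum of the R * d k l.
   An odd element is recorded by its products v k l with the d k l. *)
Definition zact i j t : V :=
  (h * (s i j * t.1 + t.2 i j),
   \matrix_(k, l) (h * (s i j * t.2 k l + t.1 * cminor i j k l))).

Definition state (w : seq ('I_n * 'I_n)) : V := foldr (fun z => zact z.1 z.2) (1, 0) w.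

Lemma zact_odd i j t : odd_part t.2 -> odd_part (zact i j t).2.
Proof.
move=> [vA vT]; split=> [a b|x a b c]; rewrite !mxE.
  by rewrite (vA a b) /cminor; ring.
transitivity (h * (s i j * (s x a * t.2 b c - s x b * t.2 a c + s x c * t.2 a b) +
  t.1 * (s x a * cminor b c i j - s x b * cminor a c i j + s x c * cminor a b i j))).
  by rewrite /cminor ![s _ i]sC ![s _ j]sC; ring.
by rewrite vT s3 !mulr0 addr0 mulr0.
Qed.

Lemma state_odd w : odd_part (state w).2.
Proof.
elim: w => [|z w IHw]; last exact: zact_odd.
by split=> *; rewrite /= !mxE; ring.
Qed.

Lemma zact_comm i j k l t : odd_part t.2 -> zact i j (zact k l t) = zact k l (zact i j t).
Proof.
move=> t_odd; congr pair; rewrite /= ?mxE.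
  by rewrite /cminor ![s _ i]sC ![s _ j]sC; ring.
apply/matrixP => p q; rewrite !mxE.
have E := odd_part_exchange k l i j p q t_odd.
transitivity (h * (s i j * (h * (s k l * t.2 p q + t.1 * cminor k l p q)) +
   (h * (s k l * t.1)) * cminor i j p q) + h * h * (t.2 k l * cminor i j p q)).
  by ring.
by rewrite E; ring.
Qed.

(** The product a i * b j * a k * b l is unchanged when b j and b l are swapped. The first component
    needs the linear relations of [odd_part], the second also [s3]. *)
Lemma zact_segre i j k l t : odd_part t.2 -> zact i j (zact k l t) = zact i l (zact k j t).
Proof.
move=> t_odd; have [vA vT] := t_odd.
(* Two three-term relations whose terms in s i k cancel; [cm2] below arises from [s3] in the same
   way. *)
have two_term : s i j * t.2 k l + s k l * t.2 i j = s i l * t.2 k j + s k j * t.2 i l.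
  have T1 := vT i j k l; have T2 := vT k i j l.
  apply/eqP; rewrite -subr_eq0; apply/eqP.
  transitivity ((s i j * t.2 k l - s i k * t.2 j l + s i l * t.2 j k) +
    (s k i * t.2 j l - s k j * t.2 i l + s k l * t.2 i j)).
    by rewrite (vA k j) (sC k i); ring.
  by rewrite T1 T2 addr0.
congr pair; rewrite /= ?mxE.
  transitivity (h * h * (t.1 * (s i j * s k l + cminor k l i j) +
    (s i j * t.2 k l + s k l * t.2 i j))); first by ring.
  by rewrite two_term /cminor (sC l i) (sC l j) (sC j i); ring.
apply/matrixP => p q; rewrite !mxE.
rewrite /=.
have E1 := odd_part_exchange k l p q i j t_odd.
have E2 := odd_part_exchange k j p q i l t_odd.
rewrite ![cminor p q _ _]cminorC in E1 E2.
transitivity (h * h * (s i j * s k l * t.2 p q + t.2 k l * cminor i j p q +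
  t.1 * (s i j * cminor k l p q + s k l * cminor i j p q))); first by ring.
have cm2 : s i j * cminor k l p q + s k l * cminor i j p q =
  s i l * cminor k j p q + s k j * cminor i l p q.
  have T1 := s3 i j k l p q; have T2 := s3 k i j l p q.
  apply/eqP; rewrite -subr_eq0; apply/eqP.
  transitivity ((s i j * cminor k l p q - s i k * cminor j l p q + s i l * cminor j k p q) +
    (s k i * cminor j l p q - s k j * cminor i l p q + s k l * cminor i j p q)).
    by rewrite (sC k i) /cminor; ring.
  by rewrite T1 T2 addr0.
transitivity (h * h * (s i l * s k j * t.2 p q + t.2 k j * cminor i l p q +
  t.1 * (s i l * cminor k j p q + s k j * cminor i l p q))); last by ring.
rewrite E1 E2 cm2 /cminor (sC l i) (sC l j) (sC j i); ring.
Qed.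

(* The z i j satisfy the Segre relations, so a product of them only depends on the multisets of
   row and column indices, i.e. on the corresponding monomial in the a i and b j. *)
Lemma state_perm w1 w2 :
  perm_eq [seq z.1 | z <- w1] [seq z.1 | z <- w2] ->
  perm_eq [seq z.2 | z <- w1] [seq z.2 | z <- w2] -> state w1 = state w2.
Proof.
have state_front z w : z \in w -> state w = state (z :: rem z w).
  elim: w => // y w IHw; rewrite inE /= => /predU1P[->|zw]; first by rewrite eqxx.
  case: eqP => [->//|_]; rewrite IHw //= zact_comm //; exact: state_odd.
elim: w1 w2 => [|[i j] w1 IHw] w2.
  by rewrite /= perm_sym => /perm_nilP; case: w2.
move=> perm1 perm2.
have [j' ij'] : exists j', (i, j') \in w2.
  have : i \in [seq z.1 | z <- w2] by rewrite -(perm_mem perm1) mem_head.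
  by case/mapP=> -[a b] abw -> /=; exists b.
have [w3 [st3 p31 p32]] : exists w3, [/\ state w2 = state ((i, j) :: w3),
    perm_eq [seq z.1 | z <- (i, j) :: w3] [seq z.1 | z <- w2] &
    perm_eq [seq z.2 | z <- (i, j) :: w3] [seq z.2 | z <- w2]].
  have perm_w2 := perm_to_rem ij'.
  have [ejj'|nejj'] := eqVneq j j'.
    exists (rem (i, j) w2); rewrite ejj'; split; first exact: state_front.
    - by rewrite perm_sym; apply: perm_map.
    - by rewrite perm_sym; apply: perm_map.
  (* Row i is paired with j', and column j with some i'; the Segre relation exchanges them into (i,
     j) and (i', j'). *)
  have [i' i'j] : exists i', (i', j) \in rem (i, j') w2.
    have : j \in [seq z.2 | z <- w2] by rewrite -(perm_mem perm2) mem_head.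
    case/mapP=> -[a b] abw /= ejb; exists a; rewrite ejb.
    move: abw; rewrite (perm_mem perm_w2) inE => /predU1P[[_ ebj']|//].
    by case/eqP: nejj'; rewrite ejb.
  pose w4 := rem (i', j) (rem (i, j') w2).
  have perm_w2' := perm_to_rem i'j; rewrite -/w4 in perm_w2'.
  have perm_w2'' : perm_eq w2 [:: (i, j'), (i', j) & w4].
    by rewrite (perm_trans perm_w2) // perm_cons.
  exists ((i', j') :: w4); split.
  - rewrite (state_front _ _ ij') /= (state_front _ _ i'j) -/w4 /=.
    by apply: zact_segre; apply: state_odd.
  - by rewrite perm_sym; apply: (perm_map _ perm_w2'').
  - rewrite perm_sym (permPl (perm_map _ perm_w2'')) /=.
    by apply/seq.permP => P /=; rewrite addnCA.
rewrite st3 /=; congr zact; apply: IHw.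
  by rewrite -(perm_cons i) -[X in perm_eq _ X]/[seq z.1 | z <- (i, j) :: w3] (permPr p31).
by rewrite -(perm_cons j) -[X in perm_eq _ X]/[seq z.2 | z <- (i, j) :: w3] (permPr p32).
Qed.

Definition distance i j := h * (s i i + s j j - s i j - s j i).

(** The operator of (a i - a j) * (b i - b j) is symmetric in i and j, so its d terms cancel and it
    is a scalar. *)
Lemma zact_distance i j t : odd_part t.2 ->
  zact i i t + zact j j t - zact i j t - zact j i t = distance i j *: t.
Proof.
(* Antisymmetry gives only that twice the diagonal vanishes; [hh] supplies the division by 2. *)
move=> [vA _]; have v0 a : t.2 a a = 0.
  by rewrite -[LHS]mul1r -hh mulrDl {1}(vA a a) mulrN addNr.
congr pair; rewrite /= ?mxE.
  rewrite -[RHS]/(distance i j * t.1) !v0 (vA i j) /distance; ring.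
by apply/matrixP => k l; rewrite !mxE /= /distance /cminor; ring.
Qed.

Lemma zact_linear i j a t u : zact i j (a *: t + u) = a *: zact i j t + zact i j u.
Proof.
congr pair; rewrite /= ?mxE.
  by rewrite -![_ *: (_ : R^o)]/(_ * _); ring.
by apply/matrixP => k l; rewrite !mxE /= -![_ *: (_ : R^o)]/(_ * _); ring.
Qed.

(** * Lifting balanced polynomials in the a_i, b_j to the module *)

Variables (F : comNzRingType) (iota : {rmorphism F -> R}).
Implicit Types (m : 'X_{1..n + n}) (p : {mpoly F[n + n]}).

Definition word (g : 'I_n -> nat) : seq 'I_n := flatten [seq nseq (g i) i | i <- enum 'I_n].

Lemma count_word g i : count_mem i (word g) = g i.
Proof.
rewrite count_flatten -map_comp sumnE big_map big_enum /= (bigD1 i) //=.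
rewrite count_nseq /= eqxx mul1n big1 ?addn0 // => j /negPf ne.
by rewrite count_nseq /= ne.
Qed.

Definition lpart m := word (fun i => m (lshift n i)).
Definition rpart m := word (fun i => m (rshift n i)).
Definition balanced m := size (lpart m) == size (rpart m).
(** The pairing chosen by [zip] is arbitrary, which [state_perm] makes harmless; balance ensures
    that [zip] drops no letter. *)
Definition mstate m := state (zip (lpart m) (rpart m)).

Lemma lpart_mul m i j : perm_eq (lpart (U_(lshift n i) + U_(rshift n j) + m)) (i :: lpart m).
Proof.
apply/allP => k _; apply/eqP => /=.
by rewrite !count_word !mnmDE !mnm1E eq_rlshift addn0 (inj_eq (@lshift_inj _ _)).
Qed.

Lemma rpart_mul m i j : perm_eq (rpart (U_(lshift n i) + U_(rshift n j) + m)) (j :: rpart m).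
Proof.
apply/allP => k _; apply/eqP => /=.
by rewrite !count_word !mnmDE !mnm1E eq_lrshift add0n (inj_eq (@rshift_inj _ _)).
Qed.

Lemma balanced_mul m i j : balanced m -> balanced (U_(lshift n i) + U_(rshift n j) + m).
Proof.
by rewrite /balanced (perm_size (lpart_mul m i j)) (perm_size (rpart_mul m i j)) eqSS.
Qed.

Lemma mstate_mul m i j : balanced m ->
  mstate (U_(lshift n i) + U_(rshift n j) + m) = zact i j (mstate m).
Proof.
move=> bm; have bm' := balanced_mul i j bm; move: (bm) (bm') => /eqP Em /eqP Em'.
rewrite -[RHS]/(state ((i, j) :: zip (lpart m) (rpart m))); apply: state_perm => /=.
  rewrite -[map _ _]/(unzip1 _) -[X in perm_eq _ (_ :: X)]/(unzip1 _).
  by rewrite !unzip1_zip ?Em ?Em' // lpart_mul.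
rewrite -[map _ _]/(unzip2 _) -[X in perm_eq _ (_ :: X)]/(unzip2 _).
by rewrite !unzip2_zip ?Em ?Em' // rpart_mul.
Qed.

(* A monomial in the variables a i = 'X_(lshift n i), b j = 'X_(rshift n j) with as many a's as
   b's is lifted to its state; [realizes] extends this linearly. *)
Definition realizes p t := exists2 ts : seq (F * 'X_{1..n + n}),
  all (fun c => balanced c.2) ts &
  p = \sum_(c <- ts) c.1 *: 'X_[c.2] /\ t = \sum_(c <- ts) iota c.1 *: mstate c.2.

Lemma realizes1 : realizes 1 (1, 0).
Proof.
have l0 : lpart 0 = [::] by apply/perm_nilP/allP => k _; apply/eqP; rewrite /= count_word mnm0E.
have r0 : rpart 0 = [::] by apply/perm_nilP/allP => k _; apply/eqP; rewrite /= count_word mnm0E.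
exists [:: (1, 0%MM)]; first by rewrite /= /balanced l0 r0.
by rewrite !big_seq1 /= rmorph1 !scale1r mpolyX0 /mstate l0 r0.
Qed.

Lemma realizesD p q t u : realizes p t -> realizes q u -> realizes (p + q) (t + u).
Proof.
move=> [ts1 b1 [-> ->]] [ts2 b2 [-> ->]]; exists (ts1 ++ ts2).
  by rewrite all_cat b1.
by rewrite !big_cat.
Qed.

Lemma realizesZ a p t : realizes p t -> realizes (a *: p) (iota a *: t).
Proof.
move=> [ts b [-> ->]]; exists [seq (a * c.1, c.2) | c <- ts].
  by rewrite all_map.
by split; rewrite big_map scaler_sumr; apply: eq_bigr => c _; rewrite /= ?rmorphM scalerA.
Qed.

Lemma realizes_mul i j p t :
  realizes p t -> realizes ('X_(lshift n i) * 'X_(rshift n j) * p) (zact i j t).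
Proof.
move=> [ts b [-> ->]].
exists [seq (c.1, U_(lshift n i) + U_(rshift n j) + c.2)%MM | c <- ts].
  by rewrite all_map; apply: sub_all b => c; apply: balanced_mul.
split; rewrite big_map.
  rewrite mulr_sumr; apply: eq_bigr => c _.
  rewrite -scalerAr !mpolyXD.
  by [].
elim: ts b => [|c ts IHts] /=.
  move=> _; rewrite !big_nil; have := zact_linear i j (-1) 0 0.
  by rewrite !scaleN1r !addr0 oppr0 => ->; rewrite addNr.
by case/andP => bc /IHts {}IHts; rewrite !big_cons zact_linear IHts mstate_mul.
Qed.

Lemma realizes_distance i j p d : realizes p (d *: (1, 0)) ->
  realizes (('X_(lshift n i) - 'X_(lshift n j)) * ('X_(rshift n i) - 'X_(rshift n j)) * p)
    ((distance i j * d) *: (1, 0)).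
Proof.
move=> rp; have rm k l := realizes_mul k l rp.
have rN q t : realizes q t -> realizes (- q) (- t).
  by move=> /(realizesZ (-1)); rewrite rmorphN rmorph1 !scaleN1r.
have := realizesD (realizesD (realizesD (rm i i) (rm j j)) (rN _ _ (rm i j)))
  (rN _ _ (rm j i)).
rewrite zact_distance; last by split=> *; rewrite /= scaler0 !mxE; ring.
rewrite scalerA; congr (realizes _ _); ring.
Qed.
Variables (N : nat) (src tgt : 'I_N -> 'I_n).

(* Squared lengths for the form x * y instead of x ^ 2 + y ^ 2: the two are equivalent over the
   complex numbers, and this one makes every entry a product of linear forms over Q. *)
Definition cayley_map : {rmorphism {mpoly F[N]} -> {mpoly F[n + n]}} :=
  mmap (@mpolyC _ F) (fun e => ('X_(lshift n (src e)) - 'X_(lshift n (tgt e))) *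
    ('X_(rshift n (src e)) - 'X_(rshift n (tgt e)))).

Definition distance_eval : {rmorphism {mpoly F[N]} -> R} :=
  mmap iota (fun e => distance (src e) (tgt e)).

Lemma realizes_cayley f : realizes (cayley_map f) (distance_eval f *: (1, 0)).
Proof.
elim/mpolyind: f => [|c m f _ _ IHf].
  by rewrite !rmorph0 scale0r; exists [::]; rewrite ?big_nil.
rewrite !rmorphD scalerDl; apply: realizesD IHf.
rewrite -mul_mpolyC !rmorphM /= !mmapC -scalerA mul_mpolyC; apply: realizesZ.
rewrite !mmapX /mmap1; elim: (index_enum _) => [|e es IHes].
  by rewrite !big_nil scale1r; apply: realizes1.
rewrite !big_cons; elim: (m e) => [|k IHk]; first by rewrite !expr0 !mul1r.
rewrite !exprS -(mulrA (_ * _)) -(mulrA (distance _ _)).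
exact: realizes_distance.
Qed.

(** Equal monomials have equal states, so grouping the terms of the lift by monomials gives
    coefficients of [cayley_map f], all zero. The lift is thus zero, and its first component is
    [distance_eval f]. *)
Theorem cayley_map_eq0 f : cayley_map f = 0 -> distance_eval f = 0.
Proof.
move=> f0; have [ts _ [def0 def_f]] := realizes_cayley f; rewrite f0 in def0.
pose ms := undup [seq c.2 | c <- ts].
have expand c : c \in ts -> iota c.1 *: mstate c.2 =
    \sum_(m <- ms) (iota (c.1 * (c.2 == m)%:R)) *: mstate m.
  move=> cts; rewrite (bigD1_seq c.2) ?undup_uniq ?mem_undup ?map_f //= eqxx mulr1.
  by rewrite big1 ?addr0 // => m /negPf ne; rewrite eq_sym ne mulr0 rmorph0 scale0r.
have {def_f} def_f : distance_eval f *: ((1, 0) : V) = 0.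
  rewrite def_f (eq_big_seq _ expand) exchange_big big1 // => m _.
  rewrite -scaler_suml -rmorph_sum; suff -> : \sum_(c <- ts) c.1 * (c.2 == m)%:R = 0.
    by rewrite rmorph0 scale0r.
  have /(congr1 (mcoeff m)) := def0; rewrite mcoeff0 raddf_sum => ts0; rewrite [RHS]ts0.
  by apply: eq_bigr => c _; rewrite /= mcoeffZ mcoeffX.
by case: def_f => + _; rewrite -[_ *: (1 : R^o)]/(_ * 1) mulr1.
Qed.

End RankTwo.

(** * Quotients and minors *)

Section IdealQuotient.
Variables (R : comNzRingType) (J : R -> Prop).
Hypotheses (J0 : J 0) (J1 : ~ J 1).
Hypothesis JD : forall x y, J x -> J y -> J (x + y).
Hypothesis JM : forall a x, J x -> J (a * x).

(** The quotient construction asks for a Boolean predicate, so membership in J is decided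
    classically. *)
Definition ideal_pred : {pred R} :=
  fun x => if excluded_middle_informative (J x) then true else false.

Lemma ideal_predP x : reflect (J x) (x \in ideal_pred).
Proof. by rewrite unfold_in; case: excluded_middle_informative => H; constructor. Qed.

Lemma ideal_pred_closed : idealr_closed ideal_pred.
Proof.
split; [exact/ideal_predP | exact/ideal_predP | move=> a x y /ideal_predP Jx /ideal_predP Jy].
by apply/ideal_predP; apply: JD => //; apply: JM.
Qed.

HB.instance Definition _ := isIdealr.Build R ideal_pred ideal_pred_closed.

Let Q := {ideal_quot ideal_pred}.

Definition quot_proj (x : R) : Q := \pi_Q%qT x.

Lemma quot_proj_zmod : zmod_morphism quot_proj.
Proof. by move=> x y; rewrite /quot_proj !piE. Qed.

Lemma quot_proj_monoid : monoid_morphism quot_proj.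
Proof. by split=> [|x y]; rewrite /quot_proj !piE. Qed.

HB.instance Definition _ := GRing.isZmodMorphism.Build R Q quot_proj quot_proj_zmod.
HB.instance Definition _ := GRing.isMonoidMorphism.Build R Q quot_proj quot_proj_monoid.

Lemma exists_quotient : exists (Q : comNzRingType) (pi : {rmorphism R -> Q}),
  forall x, pi x = 0 <-> J x.
Proof.
exists Q, quot_proj => x; rewrite -(rmorph0 quot_proj).
have -> : quot_proj x = quot_proj 0 <-> x \in ideal_pred.
  have := Quotient.idealrBE ideal_pred x 0; rewrite subr0 => ->.
  by split=> /eqP.
by split=> /ideal_predP.
Qed.

End IdealQuotient.

Section Minors.
Variables (R : comNzRingType) (N k : nat).
Implicit Types (f g : 'I_k -> 'I_N) (M : 'I_N -> 'I_N -> R).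

Lemma sorting_perm f : injective f ->
  exists p : 'S_k, forall a b : 'I_k, (a < b)%N -> (f (p a) < f (p b))%N.
Proof.
move=> f_inj; pose t := [tuple f i | i < k].
pose r := fun i j : 'I_N => (i <= j)%N.
have /tuple_permP[p def_p] : perm_eq (sort r t) t by rewrite perm_sort.
exists p => a b ab.
have sz : size (sort r t) = k by rewrite size_sort size_tuple.
have nthE i : nth (f a) (sort r t) (i : 'I_k) = f (p i).
  rewrite def_p (nth_map i) ?size_enum_ord // nth_ord_enum.
  by rewrite tnth_mktuple.
have r_trans : transitive r by move=> y x z; apply: leq_trans.
have : sorted r (sort r t) by apply: sort_sorted => x y; apply: leq_total.
move/(sorted_ltn_nth r_trans (f a))/(_ a b); rewrite !inE sz !ltn_ord.
move/(_ isT isT ab); rewrite !nthE /r leq_eqVlt => /orP[/eqP/val_inj/f_inj/perm_inj eab|//].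
by rewrite eab ltnn in ab.
Qed.

(** The generators of CM_n have increasing indices: a repeated index gives a zero minor, and sorting
    distinct ones costs a sign. *)
Lemma minor_eq0 M f g :
  (forall f g : 'I_k -> 'I_N, (forall a b : 'I_k, (a < b)%N -> (f a < f b)%N) ->
     (forall a b : 'I_k, (a < b)%N -> (g a < g b)%N) ->
     \det (\matrix_(a, b) M (f a) (g b)) = 0) ->
  \det (\matrix_(a, b) M (f a) (g b)) = 0.
Proof.
move=> M0.
have [f_inj|] := boolP (injectiveb f); last first.
  case/injectivePn => a [b ab fab]; apply: (determinant_alternate ab) => c.
  by rewrite !mxE fab.
have [g_inj|] := boolP (injectiveb g); last first.
  case/injectivePn => a [b ab gab]; rewrite -det_tr; apply: (determinant_alternate ab) => c.
  by rewrite !mxE gab.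
have [p p_sorts] := sorting_perm (injectiveP _ f_inj).
have [q q_sorts] := sorting_perm (injectiveP _ g_inj).
have := M0 _ _ p_sorts q_sorts.
have -> : \matrix_(a, b) M (f (p a)) (g (q b)) =
    row_perm p (col_perm q (\matrix_(a, b) M (f a) (g b))).
  by apply/matrixP => a b; rewrite !mxE.
rewrite row_permE col_permE !det_mulmx !det_perm => det0.
have {}det0 : \det (\matrix_(a, b) M (f a) (g b)) * (-1) ^+ q^-1%g = 0.
  by rewrite -[LHS](signrMK p) det0 mulr0.
by rewrite -[LHS](signrMK q^-1%g) [_ * \det _]mulrC det0 mulr0.
Qed.

End Minors.

Section ExplicitDeterminant.
Variable R : comNzRingType.

(** Indexing by [nat] keeps the entries computable under repeated Laplace expansion. *)
Definition ndet k (f : nat -> nat -> R) := \det (\matrix_(i < k, j < k) f i j).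

Lemma ndetS k f : ndet k.+1 f =
  \sum_(j < k.+1) f 0%N j * ((-1) ^+ j * ndet k (fun a b => f a.+1 (bump j b))).
Proof.
rewrite /ndet (expand_det_row _ ord0); apply: eq_bigr => j _.
rewrite mxE /cofactor add0n; congr (_ * (_ * \det _)).
by apply/matrixP => a b; rewrite !mxE.
Qed.

Lemma ndet0 f : ndet 0 f = 1. Proof. exact: det_mx00. Qed.

Lemma ndet3 f : ndet 3 f =
  f 0%N 0%N * (f 1%N 1%N * f 2%N 2%N - f 1%N 2%N * f 2%N 1%N)
  - f 0%N 1%N * (f 1%N 0%N * f 2%N 2%N - f 1%N 2%N * f 2%N 0%N)
  + f 0%N 2%N * (f 1%N 0%N * f 2%N 1%N - f 1%N 1%N * f 2%N 0%N).
Proof.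
do 3![rewrite !ndetS !big_ord_recl !big_ord0 /bump /=]; rewrite !ndet0.
ring.
Qed.

Lemma ndet4 f : ndet 4 f =
  f 0%N 0%N * ndet 3 (fun a b => f a.+1 (bump 0 b))
  - f 0%N 1%N * ndet 3 (fun a b => f a.+1 (bump 1 b))
  + f 0%N 2%N * ndet 3 (fun a b => f a.+1 (bump 2 b))
  - f 0%N 3%N * ndet 3 (fun a b => f a.+1 (bump 3 b)).
Proof.
rewrite ndetS !big_ord_recl !big_ord0 /=; ring.
Qed.

Variables (n : nat) (X : 'I_n -> 'I_n -> R).
Hypotheses (X0 : forall i, X i i = 0) (XC : forall i j, X i j = X j i).

Definition bordered (a b : 'I_n.+1) : R :=
  match unlift ord0 a, unlift ord0 b with
  | Some i, Some j => X i j
  | None, None => 0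
  | _, _ => 1
  end.

(* Twice the Gram matrix of the points seen from o. *)
Definition gram o i j := X o i + X o j - X i j.

(** Subtracting multiples of the border and of the row and column of o leaves minus the [gram]
    entries in the lower 3 x 3 block. *)
Lemma bordered_minor_gram o x a b c p q :
  let r u v w (i : 'I_5) :=
    nth ord0 [:: ord0; lift ord0 o; lift ord0 u; lift ord0 v; lift ord0 w] i in
  \det (\matrix_(i, j) bordered (r a b c i) (r x p q j)) =
  - (gram o x a * cminor (gram o) b c p q - gram o x b * cminor (gram o) a c p q
  + gram o x c * cminor (gram o) a b p q).
Proof.
move=> r.
pose f i j := nth 0 (nth [::] [:: [:: 0; 1; 1; 1; 1]; [:: 1; X o o; X o x; X o p; X o q];
  [:: 1; X a o; X a x; X a p; X a q];
  [:: 1; X b o; X b x; X b p; X b q]; [:: 1; X c o; X c x; X c p; X c q]] i) j.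
have -> : \det (\matrix_(i, j) bordered (r a b c i) (r x p q j)) = ndet 5 f.
  congr (\det _); apply/matrixP => i j; rewrite !mxE /bordered /r /f.
  case: i j => [[|[|[|[|[|i]]]]] lt_i] [[|[|[|[|[|j]]]]] lt_j] //=;
  by rewrite ?unlift_none ?liftK.
rewrite ndetS !big_ord_recl big_ord0 !ndet4 !ndet3 /f /bump /= /cminor /gram !X0.
rewrite (XC a o) (XC b o) (XC c o) (XC a x) (XC b x) (XC c x).
ring.
Qed.

End ExplicitDeterminant.

(** * The Cayley-Menger ideal is the kernel of the coordinate map *)

Lemma det_mul54_eq0 (R : comNzRingType) (A : 'M[R]_(5, 4)) (B : 'M[R]_(4, 5)) :
  \det (A *m B) = 0.
Proof.
pose A' : 'M[R]_5 := row_mx A (0 : 'M_(5, 1)).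
pose B' : 'M[R]_5 := col_mx B (0 : 'M_(1, 5)).
have -> : A *m B = A' *m B'.
  by rewrite /A' /B' (mul_row_col A (0 : 'M_(5, 1)) B (0 : 'M_(1, 5))) mul0mx addr0.
rewrite det_mulmx (expand_det_row B' ord_max) [X in _ * X]big1 ?mulr0 // => j _.
rewrite [B' _ _]mxE; case: splitP => [k /= k4|k _]; last by rewrite mxE mul0r.
by have := ltn_ord k; rewrite -k4.
Qed.

Definition join_fun k l T (u : 'I_k -> T) (v : 'I_l -> T) (i : 'I_(k + l)) : T :=
  match split i with inl a => u a | inr b => v b end.

Lemma sum_join_fun (R : nmodType) k l (u : 'I_k -> R) (v : 'I_l -> R) :
  \sum_(i < k) u i + \sum_(i < l) v i = \sum_(i < k + l) join_fun u v i.
Proof.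
rewrite big_split_ord; congr (_ + _); apply: eq_bigr => i _; rewrite /join_fun.
  by rewrite (unsplitK (inl i : 'I_k + 'I_l)).
by rewrite (unsplitK (inr i : 'I_k + 'I_l)).
Qed.

Section CayleyMengerIdeal.
Variable n : nat.
Implicit Types (p q : Xpoly n).

Lemma inCM0 : inCM (0 : Xpoly n).
Proof.
exists 0, (fun=> 0), (fun _ _ => ord0), (fun _ _ => ord0).
by split; [case | rewrite big_ord0].
Qed.

Lemma inCMD p q : inCM p -> inCM q -> inCM (p + q).
Proof.
move=> [k [c [f [g [fg ->]]]]] [l [d [f' [g' [fg' ->]]]]].
exists (k + l)%N, (join_fun c d), (join_fun f f'), (join_fun g g'); split.
  by move=> i; rewrite /join_fun; case: (split i).
rewrite sum_join_fun; apply: eq_bigr => i _; rewrite /join_fun.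
by case: (split i).
Qed.

Lemma inCMM p q : inCM q -> inCM (p * q).
Proof.
move=> [k [c [f [g [fg ->]]]]]; exists k, (fun i => p * c i), f, g; split=> //.
by rewrite mulr_sumr; apply: eq_bigr => i _; rewrite mulrA.
Qed.

Lemma inCM_minor5 f g : incr5 f -> incr5 g -> inCM (minor5 f g : Xpoly n).
Proof.
move=> f_inc g_inc; exists 1%N, (fun=> 1), (fun=> f), (fun=> g).
by split=> //; rewrite big_ord1 mul1r.
Qed.

Definition src (i : 'I_(nv n)) : 'I_n := (val (enum_val i : edge n)).1.
Definition tgt (i : 'I_(nv n)) : 'I_n := (val (enum_val i : edge n)).2.

Lemma xxC i j : xx i j = xx j i :> Xpoly n.
Proof.
rewrite /xx; case: insubP => [e lt_ij _|]; case: insubP => [e' lt_ji _|] //.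
by have := ltn_trans lt_ij lt_ji; rewrite ltnn.
Qed.

Lemma xx_diag i : xx i i = 0 :> Xpoly n.
Proof. by rewrite /xx insubN ?ltnn. Qed.

Lemma xx_edge i : xx (src i) (tgt i) = 'X_i.
Proof.
rewrite /xx /src /tgt -surjective_pairing valK.
by rewrite /xvar /vidx enum_valK.
Qed.

Lemma xxP i j : i = j \/ exists k, (src k = i /\ tgt k = j) \/ (src k = j /\ tgt k = i).
Proof.
have edgeP (a b : 'I_n) : (a < b)%N -> exists k, src k = a /\ tgt k = b.
  move=> ab; exists (vidx (exist _ (a, b) ab : edge n)).
  by rewrite /src /tgt /vidx enum_rankK.
case: (ltngtP i j) => [/edgeP[k ?]|/edgeP[k ?]|/val_inj]; last by left.
  by right; exists k; left.
by right; exists k; right.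
Qed.

Definition phi := cayley_map rat src tgt.

Lemma phi_xx i j : phi (xx i j) =
  ('X_(lshift n i) - 'X_(lshift n j)) * ('X_(rshift n i) - 'X_(rshift n j)).
Proof.
have phiX k : phi 'X_k = ('X_(lshift n (src k)) - 'X_(lshift n (tgt k))) *
    ('X_(rshift n (src k)) - 'X_(rshift n (tgt k))).
  by rewrite /phi /= mmapX mmap1U.
have [->|[k [] [<- <-]]] := xxP i j.
- by rewrite xx_diag rmorph0 !subrr mul0r.
- by rewrite xx_edge phiX.
- by rewrite xxC xx_edge phiX; ring.
Qed.

Lemma phi_minor5 f g : phi (minor5 f g) = 0.
Proof.
(* The bordered matrix of (a_i - a_j)(b_i - b_j) has rank at most 4. *)
pose rowL (a : 'I_n.+1) (k : 'I_4) : {mpoly rat[n + n]} :=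
  match unlift ord0 a with
  | Some i =>
    nth 0 [:: 'X_(lshift n i) * 'X_(rshift n i); - 'X_(lshift n i); - 'X_(rshift n i); 1] k
  | None => nth 0 [:: 1; 0; 0; 0] k
  end.
pose colU (b : 'I_n.+1) (k : 'I_4) : {mpoly rat[n + n]} :=
  match unlift ord0 b with
  | Some j =>
    nth 0 [:: 1; 'X_(rshift n j); 'X_(lshift n j); 'X_(lshift n j) * 'X_(rshift n j)] k
  | None => nth 0 [:: 0; 0; 0; 1] k
  end.
rewrite /minor5 -det_map_mx.
rewrite -[RHS](det_mul54_eq0 (\matrix_(a, k) rowL (f a) k) (\matrix_(k, b) colU (g b) k)).
congr (\det _); apply/matrixP => a b; rewrite !mxE.
rewrite !big_ord_recl big_ord0 !mxE /rowL /colU.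
case: (unlift ord0 (f a)) => [i|]; case: (unlift ord0 (g b)) => [j|] /=;
  rewrite ?phi_xx ?rmorph1 ?rmorph0; ring.
Qed.

Lemma inCM_phi p : inCM p -> phi p = 0.
Proof.
move=> [k [c [f [g [_ ->]]]]]; rewrite rmorph_sum big1 // => i _.
by rewrite rmorphM phi_minor5 mulr0.
Qed.

Lemma inCM_proper : ~ inCM (1 : Xpoly n).
Proof. by move/inCM_phi; rewrite rmorph1 => /eqP; rewrite oner_eq0. Qed.

Theorem phi_inCM (o : 'I_n) p : phi p = 0 -> inCM p.
Proof.
move=> phi_p0.
have [Q [pi piP]] := exists_quotient inCM0 inCM_proper inCMD inCMM.
pose X i j := pi (xx i j); pose s := gram X o.
have X0 i : X i i = 0 by rewrite /X xx_diag rmorph0.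
have XC i j : X i j = X j i by rewrite /X xxC.
have sC i j : s i j = s j i by rewrite /s /gram (XC i j); ring.
have minors0 (f g : 'I_5 -> 'I_n.+1) : \det (\matrix_(a, b) bordered X (f a) (g b)) = 0.
  apply: minor_eq0 => {f g} f g f_inc g_inc.
  have /piP := inCM_minor5 f_inc g_inc; rewrite /minor5 -det_map_mx => <-.
  congr (\det _); apply/matrixP => a b; rewrite !mxE /bordered.
  case: (unlift ord0 (f a)) => [i|]; case: (unlift ord0 (g b)) => [j|] //;
  by rewrite ?rmorph1 ?rmorph0.
have s3 (x a b c u v : 'I_n) : s x a * cminor s b c u v - s x b * cminor s a c u v +
    s x c * cminor s a b u v = 0.
  by rewrite -[LHS]opprK -(bordered_minor_gram X0 XC) minors0 oppr0.
pose h := pi (2^-1)%:MP.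
have hh : h + h = 1.
  rewrite /h -rmorphD -mpolyCD -[_ + _]/((2^-1 + 2^-1)%R : rat).
  by rewrite (_ : (2^-1 + 2^-1)%R = 1 :> rat) // mpolyC1 rmorph1.
have := cayley_map_eq0 sC hh s3 (pi \o @mpolyC _ rat) phi_p0.
(* [distance] undoes [gram]: it gives back X i j, so [distance_eval] agrees with [pi] on the
   variables. *)
suff -> : distance_eval s h (pi \o @mpolyC _ rat) src tgt p = pi p by move/piP.
apply: (mpoly_rmorph_eq (f := distance_eval s h (pi \o @mpolyC _ rat) src tgt)
  (g := pi)) => [c|i].
  by rewrite /= mmapC.
rewrite /= mmapX mmap1U -xx_edge -/(X (src i) (tgt i)) /distance /s /gram !X0.
rewrite (XC (tgt i) (src i)).
transitivity ((h + h) * X (src i) (tgt i)); first by ring.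
by rewrite hh mul1r.
Qed.

End CayleyMengerIdeal.

(** * Equilibrium stresses *)

Lemma poly_vanish_eq0 (p : {poly rat}) : (forall t, p.[t] = 0) -> p = 0.
Proof.
move=> p0; apply/eqP/negPn/negP => pn0.
pose rs : seq rat := [seq i%:R | i <- iota 0 (size p)].
suff : (size rs < size p)%N by rewrite size_map size_iota ltnn.
apply: max_poly_roots => //; first by apply/allP => t _; rewrite /root p0.
by rewrite map_inj_uniq ?iota_uniq // => i j /eqP; rewrite eqr_nat => /eqP.
Qed.

Section Pencil.
Variables (I K : finType).
Implicit Types (A B : I -> K -> rat) (w : I -> rat).

Definition injective_system A :=
  forall w, (forall k, \sum_i w i * A i k = 0) -> forall i, w i = 0.

(** Injectivity is an open condition; on a line it can fail only at the roots of a nonzero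
    polynomial. This allows generic choices over the rationals. *)
Lemma injective_pencil A B : injective_system A ->
  exists2 h : {poly rat}, h != 0 &
    forall t, h.[t] != 0 -> injective_system (fun i k => A i k + t * B i k).
Proof.
move=> injA.
pose MA := \matrix_(i < #|I|, k < #|K|) A (enum_val i) (enum_val k).
pose MB := \matrix_(i < #|I|, k < #|K|) B (enum_val i) (enum_val k).
have sumE (C : I -> K -> rat) w k :
    ((\row_i w (enum_val i)) *m \matrix_(i < #|I|, k < #|K|) C (enum_val i) (enum_val k)) 0 k
    = \sum_i w i * C i (enum_val k).
  rewrite mxE (reindex_onto enum_rank enum_val) /=; last by move=> i _; rewrite enum_valK.
  by apply: eq_big => [i|i _]; rewrite ?mxE ?enum_rankK ?eqxx.
(* For a right inverse N of MA, the polynomial \det ((MA + t MB) N) takes the value 1 at 0. *)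
have freeA : row_free MA.
  rewrite -kermx_eq0; apply/eqP/row_matrixP => i; rewrite row0.
  have : row i (kermx MA) *m MA = 0 by rewrite -row_mul mulmx_ker row0.
  move: (row i _) => r r0.
  have {}r0 : forall j, r 0 (enum_rank j) = 0.
    apply: injA => k; rewrite -(enum_rankK k) -sumE -/MA.
    rewrite (_ : \row_i _ = r) ?r0 ?mxE //.
    by apply/rowP => j; rewrite mxE enum_valK.
  by apply/rowP => j; rewrite -(enum_valK j) r0 mxE.
have [N AN] := row_freeP freeA.
pose P := map_mx polyC (MA *m N) + 'X *: map_mx polyC (MB *m N).
have Pt t : (\det P).[t] = \det ((MA + t *: MB) *m N).
  rewrite -horner_evalE -det_map_mx; congr (\det _).
  rewrite mulmxDl -scalemxAl; apply/matrixP => i j; move: (MA *m N) (MB *m N) @P => C D P.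
  by rewrite /P !mxE /= /horner_eval hornerD hornerM !hornerC hornerX.
exists (\det P).
  apply: contraTneq (oner_neq0 rat) => P0.
  by rewrite negbK -(det1 rat #|I|) -AN -[MA]addr0 -(scale0r MB) -Pt P0 horner0.
move=> t; rewrite Pt => det_neq0 w w0 i.
pose r : 'rV_#|I| := \row_i w (enum_val i).
have r0 : r *m (MA + t *: MB) = 0.
  apply/rowP => k; rewrite mxE [RHS]mxE -[RHS](w0 (enum_val k)).
  rewrite -(sumE (fun i k => A i k + t * B i k)).
  by rewrite !mxE; apply: eq_bigr => j _; rewrite !mxE.
have : r *m ((MA + t *: MB) *m N) = 0 by rewrite mulmxA r0 mul0mx.
move=> rN0; have U : (MA + t *: MB) *m N \in unitmx by rewrite unitmxE unitfE.
have /rowP/(_ (enum_rank i)) : r = 0 by rewrite -(mulmxK U r) rN0 mul0mx.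
by rewrite !mxE enum_rankK.
Qed.

End Pencil.

Section Stress.
Variable T : finType.
Implicit Types (g : rel T) (x y : T -> rat) (w : T -> T -> rat).

(** A linear dependency between the rows of the rigidity matrix, written as a symmetric function of
    ordered pairs. *)
Definition stress g x y w := [/\ forall i j, w i j = w j i,
  forall i j, ~~ g i j -> w i j = 0, forall i, \sum_j w i j * (x i - x j) = 0 &
  forall i, \sum_j w i j * (y i - y j) = 0].

Definition stressfree g x y := forall w, stress g x y w -> forall i j, w i j = 0.

(** One column per condition of [stress]. The factor a scales the conditions independent of the
    positions: a = 1 gives the system of a framework, a = 0 its variation along a line. *)
Definition stress_system g (a : rat) x y (e : T * T) (k : T * T + T * T + T + T) : rat :=
  match k with
  | inl (inl (inl z)) => a * ((e == z)%:R - (e == (z.2, z.1))%:R)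
  | inl (inl (inr z)) => a * (if g z.1 z.2 then 0 else (e == z)%:R)
  | inl (inr i) => (e.1 == i)%:R * (x e.1 - x e.2)
  | inr i => (e.1 == i)%:R * (y e.1 - y e.2)
  end.

Lemma sum_delta (I : finType) (w : I -> rat) z : \sum_e w e * (e == z)%:R = w z.
Proof.
rewrite (bigD1 z) //= eqxx mulr1 big1 ?addr0 // => e /negPf ->.
by rewrite mulr0.
Qed.

Lemma sum_row (w : T * T -> rat) (c : T * T -> rat) i :
  \sum_e w e * ((e.1 == i)%:R * c e) = \sum_j w (i, j) * c (i, j).
Proof.
transitivity (\sum_k \sum_j w (k, j) * ((k == i)%:R * c (k, j))).
  by rewrite pair_bigA; apply: eq_bigr => -[k j] _.
rewrite (bigD1 i) //= [X in _ + X]big1 ?addr0 => [|k /negPf ne].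
  by apply: eq_bigr => j _; rewrite eqxx mul1r.
by rewrite big1 // => j _; rewrite ne mul0r mulr0.
Qed.

Lemma stressfreeP g x y : stressfree g x y <-> injective_system (stress_system g 1 x y).
Proof.
split=> [free w w0 [i j]|inj w [wC wg wx wy] i j].
  apply: (free (fun i j => w (i, j))); split=> [k l|k l gkl|k|k].
  - have := w0 (inl (inl (inl (k, l)))) => /=.
    under eq_bigr => e _ do rewrite mul1r mulrBr.
    by rewrite sumrB !sum_delta => /eqP; rewrite subr_eq0 => /eqP.
  - have := w0 (inl (inl (inr (k, l)))) => /=.
    by rewrite (negPf gkl); under eq_bigr => e _ do rewrite mul1r; rewrite sum_delta.
  - by have := w0 (inl (inr k)) => /=; rewrite sum_row.
  - by have := w0 (inr k) => /=; rewrite sum_row.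
apply: (inj (fun e => w e.1 e.2) _ (i, j)) => -[[[[k l]|[k l]]|k]|k] /=.
- transitivity (\sum_e (w e.1 e.2 * (e == (k, l))%:R - w e.1 e.2 * (e == (l, k))%:R)).
    by apply: eq_bigr => e _; ring.
  by rewrite sumrB !(sum_delta (fun e => w e.1 e.2)) /= wC subrr.
- case: (boolP (g k l)) => [_|/wg w0]; first by rewrite big1 // => e _; rewrite !mulr0.
  rewrite -[RHS]w0 -(sum_delta (fun e => w e.1 e.2) (k, l)).
  by apply: eq_bigr => e _; rewrite mul1r.
- by rewrite (sum_row (fun e => w e.1 e.2) (fun e => x e.1 - x e.2)) /=.
- by rewrite (sum_row (fun e => w e.1 e.2) (fun e => y e.1 - y e.2)) /=.
Qed.

Definition along (t : rat) x x1 : T -> rat := fun i => x i + t * (x1 i - x i).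

Lemma stressfree_line g x y x1 y1 : stressfree g x y ->
  exists2 h : {poly rat}, h != 0 &
    forall t, h.[t] != 0 -> stressfree g (along t x x1) (along t y y1).
Proof.
pose dx i := x1 i - x i; pose dy i := y1 i - y i.
move/stressfreeP/(injective_pencil (stress_system g 0 dx dy)).
case=> h h0 H; exists h => // t /H inj; apply/stressfreeP => w w0.
apply: inj => k; rewrite -[RHS](w0 k); apply: eq_bigr => e _; congr (_ * _).
by case: k => [[[z|z]|i]|i] /=; rewrite /along /dx /dy; ring.
Qed.

(** On the line towards a framework with a at (1, 0), b at (0, 1) and c at the origin, the
    determinant is a polynomial q with q(1) = 1. A parameter outside the roots of h * q serves both
    requirements. *)
Lemma stressfree_noncollinear g x y a b c : a != b -> a != c -> b != c ->
  stressfree g x y -> exists x' y', stressfree g x' y' /\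
    (x' a - x' c) * (y' b - y' c) - (x' b - x' c) * (y' a - y' c) != 0.
Proof.
move=> ab ac bc free.
pose x1 i : rat := (i == a)%:R; pose y1 i : rat := (i == b)%:R.
have [h h0 freeh] := stressfree_line x1 y1 free.
pose line (z z1 : T -> rat) i : {poly rat} := (z i)%:P + 'X * (z1 i - z i)%:P.
have lineE (z z1 : T -> rat) i t : (line z z1 i).[t] = along t z z1 i.
  by rewrite /line /along hornerD hornerM !hornerC hornerX.
clearbody line.
pose q := (line x x1 a - line x x1 c) * (line y y1 b - line y y1 c) -
  (line x x1 b - line x x1 c) * (line y y1 a - line y y1 c).
have qE (t : rat) : q.[t] =
    (along t x x1 a - along t x x1 c) * (along t y y1 b - along t y y1 c) -
    (along t x x1 b - along t x x1 c) * (along t y y1 a - along t y y1 c).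
  by rewrite /q !(hornerD, hornerN, hornerM) !lineE.
have q1 : q.[1] = 1.
  have along1 (z z1 : T -> rat) i : along 1 z z1 i = z1 i by rewrite /along; ring.
  rewrite qE !along1 /x1 /y1 !eqxx (eq_sym b a) (eq_sym c a) (eq_sym c b).
  by rewrite (negPf ab) (negPf ac) (negPf bc) /=; ring.
have q0 : q != 0.
  by apply: contraTneq (oner_neq0 rat) => q0; rewrite -q1 q0 horner0 eqxx.
have : h * q != 0 by rewrite mulf_neq0.
move=> hq0; have [t ht] : exists t, (h * q).[t] != 0.
  apply: NNPP => no_t; case/eqP: hq0; apply: poly_vanish_eq0 => t.
  by apply/eqP/negPn/negP => ht; apply: no_t; exists t.
move: ht; rewrite hornerM mulf_eq0 negb_or => /andP[ht qt].
exists (along t x x1), (along t y y1); split; first exact: freeh.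
by rewrite -qE.
Qed.

End Stress.

(** * Laman's theorem *)

Section SparseGraphs.
Variable n : nat.
Local Notation T := 'I_n.
Implicit Types (g : rel T) (V : {set T}).
Local Open Scope nat_scope.

(* Every edge is counted twice, once for each orientation. *)
Definition nb_arcs g V := \sum_i \sum_j ([&& g i j, i \in V & j \in V] : nat).

(** Laman's bound 2|V| - 3 on edges, doubled to count arcs and written without subtraction. *)
Definition sparse g := forall V, 2 <= #|V| -> nb_arcs g V + 6 <= 4 * #|V|.

(** The vertex v remains as an isolated vertex, so all graphs share one vertex type and induction
    runs on the number of active vertices. *)
Definition del g v : rel T := fun i j => [&& g i j, i != v & j != v].

Definition add g a b : rel T :=
  fun i j => [|| g i j, (i == a) && (j == b) | (i == b) && (j == a)].

Lemma nb_arcs_even g V : ssrbool.symmetric g -> irreflexive g -> ~~ odd (nb_arcs g V).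
Proof.
move=> gC g0; pose h i j : nat := [&& g i j, i \in V & j \in V] && (i < j).
suff -> : nb_arcs g V = (\sum_i \sum_j h i j).*2 by rewrite odd_double.
rewrite -addnn {2}exchange_big -big_split; apply: eq_bigr => i _.
rewrite -big_split; apply: eq_bigr => j _; rewrite /h (gC j i).
case: (ltngtP i j) => [ij|ij|/val_inj ->]; last by rewrite g0.
  by case: (g i j); case: (i \in V); case: (j \in V).
by case: (g i j); case: (i \in V); case: (j \in V).
Qed.

Lemma nb_arcs_cup g V W :
  nb_arcs g V + nb_arcs g W <= nb_arcs g (V :|: W) + nb_arcs g (V :&: W).
Proof.
rewrite -!big_split; apply: leq_sum => i _; rewrite -!big_split; apply: leq_sum => j _.
rewrite /= !inE; case: (g i j) => //=.
by case: (i \in V); case: (j \in V); case: (i \in W); case: (j \in W).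
Qed.

(** Two distinct vertices lie together in at most one of the three sets, so no arc is counted
    twice. *)
Lemma nb_arcs_cup3 g U V W : irreflexive g ->
    #|U :&: V| <= 1 -> #|U :&: W| <= 1 -> #|V :&: W| <= 1 ->
  nb_arcs g U + nb_arcs g V + nb_arcs g W <= nb_arcs g (U :|: V :|: W).
Proof.
move=> g0 /card_le1_eqP UV /card_le1_eqP UW /card_le1_eqP VW.
rewrite -!big_split; apply: leq_sum => i _; rewrite -!big_split; apply: leq_sum => j _.
have [->|ij] := eqVneq i j; first by rewrite g0.
have {}UV := UV i j; have {}UW := UW i j; have {}VW := VW i j.
rewrite !inE in UV UW VW *; case: (g i j) => //=.
case: (i \in U) UV UW => UV UW; case: (i \in V) UV VW => UV VW;
case: (i \in W) UW VW => UW VW; case: (j \in U) UV UW => UV UW; case: (j \in V) UV VW => UV VW;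
case: (j \in W) UW VW => UW VW //=; exfalso; move: ij;
by rewrite ?(UV isT isT) ?(UW isT isT) ?(VW isT isT) eqxx.
Qed.

Lemma nb_arcs_sub g g' V : (forall i j, g i j -> g' i j) -> nb_arcs g V <= nb_arcs g' V.
Proof.
move=> sub; apply: leq_sum => i _; apply: leq_sum => j _.
by case: (boolP (g i j)) => [/sub ->|].
Qed.

Lemma sum_pair_delta (p q : T) : \sum_(i : T) \sum_(j : T) ((i == p) && (j == q) : nat) = 1.
Proof.
rewrite (bigD1 p) //= (bigD1 q) //= !eqxx big1 ?big1 // => [i /negPf ne|j /negPf ne].
  by rewrite big1 // => j _; rewrite ne.
by rewrite ne.
Qed.

Lemma nb_arcs_add g a b V : a \in V -> b \in V -> 
  nb_arcs (add g a b) V <= nb_arcs g V + 2.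
Proof.
move=> aV bV; rewrite -[2]/(1 + 1) -{1}(sum_pair_delta a b) -(sum_pair_delta b a).
rewrite -!big_split; apply: leq_sum => i _.
rewrite -!big_split; apply: leq_sum => j _; rewrite /add.
by case: (g i j) (i == a) (j == b) (i == b) (j == a) (i \in V) (j \in V)
  => [] [] [] [] [] [] [].
Qed.

Lemma nb_arcs_add_out g a b V : ~~ ((a \in V) && (b \in V)) -> 
  nb_arcs (add g a b) V = nb_arcs g V.
Proof.
move=> abV; apply: eq_bigr => i _; apply: eq_bigr => j _; rewrite /add.
case: (g i j) => //=; case: (boolP ((i == a) && (j == b))) => [/andP[/eqP -> /eqP ->]|_].
  by rewrite (negPf abV).
case: (boolP ((i == b) && (j == a))) => [/andP[/eqP -> /eqP ->]|_] //=.
by rewrite andbC (negPf abV).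
Qed.

Section DegreeThree.
Variables (g : rel T) (v a b c : T).
Hypotheses (gC : ssrbool.symmetric g) (g0 : irreflexive g) (sg : sparse g).
Hypotheses (va : g v a) (vb : g v b) (vc : g v c) (ab : a != b) (ac : a != c) (bc : b != c).

Let g' := del g v.

Let g'C : ssrbool.symmetric g'.
Proof. by move=> i j; rewrite /g' /del gC; congr (_ && _); rewrite andbC. Qed.

Let g'0 : irreflexive g'.
Proof. by move=> i; rewrite /g' /del g0. Qed.

Let sg' : sparse g'.
Proof.
move=> V V2; apply: leq_trans (sg V2); rewrite leq_add2r; apply: nb_arcs_sub.
by move=> i j /and3P[].
Qed.

Let not_v i : g v i -> i != v.
Proof. by apply: contraTneq => ->; rewrite g0. Qed.

(** Adding v to such a set brings six arcs but raises the bound only by 4, so a tight set would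
    violate sparsity of g. If V already contains v, that isolated vertex is removed first. *)
Let no_tight V : a \in V -> b \in V -> c \in V -> nb_arcs g' V + 6 < 4 * #|V|.
Proof.
move=> aV bV cV; pose U := V :\ v.
have g'U : nb_arcs g' V = nb_arcs g' U.
  apply: eq_bigr => i _; apply: eq_bigr => j _; rewrite /g' /del !inE.
  by case: (i == v); case: (j == v); rewrite ?andbF.
have : nb_arcs g' U + (1 + 1) + (1 + 1) + (1 + 1) <= nb_arcs g (v |: U).
  rewrite -{1}(sum_pair_delta v a) -{1}(sum_pair_delta a v) -{1}(sum_pair_delta v b).
  rewrite -{1}(sum_pair_delta b v) -{1}(sum_pair_delta v c) -(sum_pair_delta c v).
  rewrite -!big_split; apply: leq_sum => i _; rewrite -!big_split; apply: leq_sum => j _.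
  have nva := not_v va; have nvb := not_v vb; have nvc := not_v vc.
  rewrite /g' /del /U /= !inE.
  have [->|iv] := eqVneq i v.
    rewrite /= andbF /= !(eq_sym v) (negPf nva) (negPf nvb) (negPf nvc) /= !addn0.
    have [->|_] := eqVneq j a; first by rewrite va aV (negPf ab) (negPf ac) nva orbT.
    have [->|_] := eqVneq j b; first by rewrite vb bV (negPf bc) nvb orbT.
    by have [->|_] := eqVneq j c; first by rewrite vc cV nvc orbT.
  have [->|jv] := eqVneq j v.
    rewrite /= !andbF /= ?(eq_sym v) ?(negPf nva) ?(negPf nvb) ?(negPf nvc).
    rewrite ?andbF ?andbT ?add0n /= gC.
    have [->|_] := eqVneq i a; first by rewrite va aV (negPf ab) (negPf ac).
    have [->|_] := eqVneq i b; first by rewrite vb bV (negPf bc).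
    by have [->|_] := eqVneq i c; first by rewrite vc cV.
  rewrite !andbF !addn0 /= !andbT; by case: (g i j).
have U3 : 2 < #|U|.
  have sub : [set a; b; c] \subset U.
    by apply/subsetP => k; rewrite !inE => /orP[/orP[]|] /eqP ->; rewrite ?not_v ?aV ?bV ?cV.
  apply: leq_trans (subset_leq_card sub).
  by rewrite setUC cardsU1 cards2 !inE ab negb_or !(eq_sym c) ac bc.
move=> H1; have cardvU : #|v |: U| = #|U|.+1 by rewrite cardsU1 !inE eqxx.
have H2 : nb_arcs g (v |: U) + 6 <= 4 * #|v |: U|.
  by apply: sg; rewrite cardvU; apply: leqW; apply: ltnW.
have H3 : #|U| <= #|V| by apply/subset_leq_card/subsetDl.
rewrite g'U; move: H1 H2 H3; rewrite cardvU.
by move: (nb_arcs g' U) (nb_arcs g _) #|U| #|V| => d e u w; clear; lia.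
Qed.

(** If pq is already an edge, {p, q} is tight. Otherwise some V containing p and q breaks the bound
    once pq adds its two arcs; as the number of arcs is even, V was tight before. *)
Let tight_pair p q : p != q -> p != v -> q != v ->
    ~ (~~ g' p q /\ sparse (add g' p q)) ->
  exists V, [/\ p \in V, q \in V & 4 * #|V| <= nb_arcs g' V + 6].
Proof.
move=> pq pv qv not_add; have [gpq|gpq] := boolP (g' p q).
  exists [set p; q]; rewrite !inE !eqxx orbT cards2 pq; split=> //.
  have : nb_arcs (fun i j => (i == p) && (j == q) || (i == q) && (j == p)) [set p; q]
      <= nb_arcs g' [set p; q].
    apply: nb_arcs_sub => i j /orP[] /andP[/eqP -> /eqP ->] //.
    by rewrite g'C.
  suff : 2 <= nb_arcs (fun i j => (i == p) && (j == q) || (i == q) && (j == p)) [set p; q].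
    move: (nb_arcs _ _) (nb_arcs _ _) => d e; clear; lia.
  rewrite -[2]/(1 + 1) -{1}(sum_pair_delta p q) -(sum_pair_delta q p) -!big_split.
  apply: leq_sum => i _; rewrite -!big_split; apply: leq_sum => j _; rewrite /= !inE.
  have [->|ip] := eqVneq i p; have [->|jp] := eqVneq j p;
    rewrite ?(negPf pq) ?andbF ?orbF ?eqxx //= ?(eq_sym p) ?(negPf pq);
    by case: (_ == q); rewrite //=; case: (_ == q).
have [V [V2 Vbig]] : exists V, 2 <= #|V| /\ 4 * #|V| < nb_arcs (add g' p q) V + 6.
  apply: NNPP => noV; apply: not_add; split=> // V V2.
  by rewrite leqNgt; apply/negP => Vbig; apply: noV; exists V.
have small := sg' V2.
have [/andP[pV qV]|] := boolP ((p \in V) && (q \in V)); last first.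
  by move/nb_arcs_add_out => E; move: Vbig; rewrite E ltnNge small.
exists V; split=> //.
have := nb_arcs_add g' pV qV; have := nb_arcs_even V g'C g'0.
rewrite -(odd_double_half (nb_arcs g' V)).
move: Vbig; move: (nb_arcs (add _ _ _) V) (nb_arcs g' V) #|V| => d e m Hd.
by rewrite oddD odd_double addbF oddb => /negPf ->; move: e./2 Hd => h; clear; lia.
Qed.

(* If the three pairs were all blocked by tight sets, then two of these sets meeting in two points,
   or else all three, would have a tight union containing a, b, c, against [no_tight]. *)
Lemma degree3_reduction :
  [\/ ~~ g' a b /\ sparse (add g' a b), ~~ g' a c /\ sparse (add g' a c) |
     ~~ g' b c /\ sparse (add g' b c)].
Proof.
apply: NNPP => none.
have [A [aA bA tA]] := tight_pair ab (not_v va) (not_v vb) (fun H => none (Or31 _ _ H)).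
have [B [aB cB tB]] := tight_pair ac (not_v va) (not_v vc) (fun H => none (Or32 _ _ H)).
have [C [bC cC tC]] := tight_pair bc (not_v vb) (not_v vc) (fun H => none (Or33 _ _ H)).
have pairwise (U V : {set T}) : 4 * #|U| <= nb_arcs g' U + 6 -> 4 * #|V| <= nb_arcs g' V + 6 ->
    a \in U :|: V -> b \in U :|: V -> c \in U :|: V -> #|U :&: V| <= 1.
  move=> tU tV aUV bUV cUV; rewrite leqNgt; apply/negP => UV2.
  have := no_tight aUV bUV cUV; have := sg' UV2; have := nb_arcs_cup g' U V.
  have := cardsUI U V; move: tU tV; move: (nb_arcs g' U) (nb_arcs g' V).
  move: (nb_arcs g' _) (nb_arcs g' _) #|U :|: V| #|U :&: V| #|U| #|V|.
  move=> d1 d2 n1 n2 n3 n4 d3 d4.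
  by clear; lia.
have AB : #|A :&: B| <= 1 by apply: pairwise => //; rewrite !inE ?aA ?bA ?cB ?orbT.
have AC : #|A :&: C| <= 1 by apply: pairwise => //; rewrite !inE ?aA ?bA ?cC ?orbT.
have BC : #|B :&: C| <= 1 by apply: pairwise => //; rewrite !inE ?aB ?bC ?cB ?orbT.
(* Overlaps cost at least three vertices in the union, one in A and B, two in (A or B) and C. These
   12 units offset the excess of 3 * 6 over 6, so the union is tight. *)
have := nb_arcs_cup3 g'0 AB AC BC.
have := @no_tight (A :|: B :|: C); rewrite !inE aA bA cB !orbT => /(_ isT isT isT).
have : 0 < #|A :&: B| by apply/card_gt0P; exists a; rewrite !inE aA.
have : 1 < #|(A :|: B) :&: C|.
  by apply/card_gt1P; exists b, c; split=> //; rewrite !inE ?bA ?bC ?cB ?cC ?orbT.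
have := cardsUI A B; have := cardsUI (A :|: B) C; move: tA tB tC.
move: (nb_arcs g' A) (nb_arcs g' B) (nb_arcs g' C) (nb_arcs g' _) => d1 d2 d3 d4.
move: #|(A :|: B) :&: C| #|A :|: B :|: C| #|A :|: B| #|A :&: B| #|A| #|B| #|C|.
by move=> n1 n2 n3 n4 n5 n6 n7; clear; lia.
Qed.

End DegreeThree.

Lemma sparse_sub g g' : (forall i j, g i j -> g' i j) -> sparse g' -> sparse g.
Proof.
by move=> sub sg' V V2; apply: leq_trans (sg' V V2); rewrite leq_add2r; apply: nb_arcs_sub.
Qed.

Definition active g : {set T} := [set i | [exists j, g i j]].

(** Otherwise every active vertex has degree at least 4, and the arcs among active vertices exceed
    the bound. *)
Lemma exists_low_degree g :
    ssrbool.symmetric g -> irreflexive g -> sparse g -> active g != set0 ->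
  exists2 v, v \in active g & 0 < #|[set j | g v j]| <= 3.
Proof.
move=> gC g0 sg /set0Pn[v0 v0A].
apply: NNPP => no_low.
have deg4 v : v \in active g -> 4 <= #|[set j | g v j]|.
  move=> vA; rewrite ltnNge; apply/negP => le3; apply: no_low; exists v => //.
  rewrite le3 andbT; move: vA; rewrite inE => /existsP[j gvj].
  by apply/card_gt0P; exists j; rewrite inE.
have A2 : 2 <= #|active g|.
  move: v0A; rewrite inE => /existsP[j gvj]; apply/card_gt1P; exists v0, j.
  split; rewrite ?inE; [by apply/existsP; exists j | by apply/existsP; exists v0; rewrite gC |].
  by apply: contraTneq gvj => ->; rewrite g0.
have := sg _ A2; rewrite leqNgt => /negP[].
suff le4 : 4 * #|active g| <= nb_arcs g (active g).
  by rewrite -(addn1 (4 * _)) (leq_add le4).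
rewrite mulnC -sum_nat_const [leqRHS](bigID (mem (active g))) /=.
apply: leq_trans (leq_addr _ _); apply: leq_sum => i iA.
apply: leq_trans (deg4 i iA) _; rewrite -sum1_card big_mkcond /=.
apply: leq_sum => j _; rewrite inE; case: (boolP (g i j)) => //= gij.
by rewrite iA inE; case: existsP => // -[]; exists i; rewrite gC.
Qed.

Lemma del_sym g v : ssrbool.symmetric g -> ssrbool.symmetric (del g v).
Proof. by move=> gC i j; rewrite /del gC; congr (_ && _); rewrite andbC. Qed.

Lemma del_irr g v : irreflexive g -> irreflexive (del g v).
Proof. by move=> g0 i; rewrite /del g0. Qed.

Lemma add_sym g a b : ssrbool.symmetric g -> ssrbool.symmetric (add g a b).
Proof.
move=> gC i j; rewrite /add gC; congr (_ || _).
by rewrite orbC andbC [(j == b) && _]andbC.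
Qed.

Lemma add_irr g a b : a != b -> irreflexive g -> irreflexive (add g a b).
Proof.
move=> ab g0 i; rewrite /add g0 /=; have [->|_] := eqVneq i a; first by rewrite (negPf ab).
by rewrite andbF.
Qed.

Local Close Scope nat_scope.

Definition move_to (v : T) (z : T -> rat) (c : rat) : T -> rat :=
  fun i => if i == v then c else z i.

Lemma stress_del g v x y c d w : stressfree (del g v) x y ->
    stress g (move_to v x c) (move_to v y d) w -> (forall j, w v j = 0) ->
  forall i j, w i j = 0.
Proof.
move=> free [wC wg wx wy] wv; apply: free.
have moved (z : T -> rat) k :
    (forall i, \sum_j w i j * (move_to v z k i - move_to v z k j) = 0) ->
    forall i, \sum_j w i j * (z i - z j) = 0.
  move=> wz i; have [->|iv] := eqVneq i v.
    by rewrite big1 // => j _; rewrite wv mul0r.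
  rewrite -[RHS](wz i); apply: eq_bigr => j _; rewrite /move_to (negPf iv).
  by have [->|//] := eqVneq j v; rewrite wC wv !mul0r.
split=> // [i j|i|i]; [|exact: (moved x c)|exact: (moved y d)].
rewrite /del !negb_and !negbK => /or3P[/wg //|/eqP ->|/eqP ->]; first exact: wv.
by rewrite wC wv.
Qed.

Lemma sum_support (S : {set T}) (F : T -> rat) :
  (forall j, j \notin S -> F j = 0) -> \sum_j F j = \sum_(j in S) F j.
Proof. by move=> F0; rewrite (bigID (mem S)) /= [X in _ + X]big1 ?addr0. Qed.

Lemma stressfree_sub g g' x y : (forall i j, g i j -> g' i j) ->
  stressfree g' x y -> stressfree g x y.
Proof.
move=> sub free w [wC wg wx wy]; apply: free; split=> // i j ng'.
by apply: wg; apply: contra ng'; apply: sub.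
Qed.

Lemma row_sum_at g v (S : {set T}) (z : T -> rat) k w :
    irreflexive g -> (forall j, g v j -> j \in S) ->
    (forall i j, ~~ g i j -> w i j = 0) ->
    (forall i, \sum_j w i j * (move_to v z k i - move_to v z k j) = 0) ->
  \sum_(j in S) w v j * (k - z j) = 0.
Proof.
move=> g0 gS wg wz; rewrite -[RHS](wz v) -(@sum_support S) => [|j jS].
  apply: eq_bigr => j _; rewrite /move_to eqxx; have [->|//] := eqVneq j v.
  by rewrite wg ?g0 // !mul0r.
by rewrite wg ?mul0r //; apply: contra jS; apply: gS.
Qed.

Lemma henneberg_deg1 g v a x y : irreflexive g ->
    (forall j, g v j -> j \in [set a]) -> stressfree (del g v) x y ->
  exists x y : T -> rat, stressfree g x y.
Proof.
(* With v shifted by 1 from a in the x direction, equilibrium at v reads w v a = 0. *)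
move=> g0 gS free; exists (move_to v x (x a + 1)), (move_to v y (y a)) => w sw.
apply: (stress_del free sw) => j; case: sw => wC wg wx _.
have := row_sum_at g0 gS wg wx; rewrite big_set1 addrAC subrr add0r mulr1 => wa.
have [/gS|/wg //] := boolP (g v j); by rewrite inE => /eqP ->.
Qed.

Lemma henneberg1 g v a b x y : irreflexive g -> a != b -> a != v -> b != v ->
    (forall j, g v j -> j \in [set a; b]) -> stressfree (del g v) x y ->
  exists x y : T -> rat, stressfree g x y.
Proof.
move=> g0 ab av bv gS free0.
(* As v is isolated in [del g v], it can be taken off the line ab; Cramer's rule then kills both
   stresses at v. *)
have [x' [y' [free cross]]] := stressfree_noncollinear ab av bv free0.
exists (move_to v x' (x' v)), (move_to v y' (y' v)) => w sw.
apply: (stress_del free sw) => j; case: sw => wC wg wx wy.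
have := row_sum_at g0 gS wg wx; rewrite big_setU1 ?inE //= big_set1 => eqx.
have := row_sum_at g0 gS wg wy; rewrite big_setU1 ?inE //= big_set1 => eqy.
have wa : w v a = 0.
  apply: (mulIf cross); rewrite mul0r.
  transitivity (- (w v a * (x' v - x' a) + w v b * (x' v - x' b)) * (y' b - y' v) +
    (w v a * (y' v - y' a) + w v b * (y' v - y' b)) * (x' b - x' v)); first by ring.
  by rewrite eqx eqy oppr0 !mul0r addr0.
have wb : w v b = 0.
  apply: (mulIf cross); rewrite mul0r.
  transitivity ((w v a * (x' v - x' a) + w v b * (x' v - x' b)) * (y' a - y' v) -
    (w v a * (y' v - y' a) + w v b * (y' v - y' b)) * (x' a - x' v)); first by ring.
  by rewrite eqx eqy !mul0r subr0.
have [/gS|/wg //] := boolP (g v j); by rewrite !inE => /orP[] /eqP ->.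
Qed.

(* The vertex v is placed at the midpoint of a and b: a stress must then vanish on the edge vc, and
   its values on va and vb combine into a stress on the new edge ab. *)
Lemma henneberg2 g v a b c x y : ssrbool.symmetric g -> irreflexive g ->
    a != b -> a != c -> b != c -> a != v -> b != v ->
    (forall j, g v j -> j \in [set a; b; c]) -> ~~ del g v a b ->
    stressfree (add (del g v) a b) x y ->
  exists x y : T -> rat, stressfree g x y.
Proof.
move=> gC g0 ab ac bc av bv gS gab free0.
have [x' [y' [free cross]]] := stressfree_noncollinear ab ac bc free0.
have freedel : stressfree (del g v) x' y'.
  by apply: stressfree_sub free => i j gij; rewrite /add gij.
pose mid (z : T -> rat) := (z a + z b) / 2.
exists (move_to v x' (mid x')), (move_to v y' (mid y')) => w sw.
apply: (stress_del freedel sw); case: sw => wC wg wx wy.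
have sumS (F : T -> rat) : \sum_(j in [set a; b; c]) F j = F a + F b + F c.
  by rewrite setUC big_setU1 ?big_setU1 ?big_set1 /= ?inE ?negb_or ?(eq_sym c) ?ac ?bc // addrC.
have := row_sum_at g0 gS wg wx; rewrite sumS => eqx.
have := row_sum_at g0 gS wg wy; rewrite sumS => eqy.
pose E (z : T -> rat) :=
  w v a * (mid z - z a) + w v b * (mid z - z b) + w v c * (mid z - z c).
rewrite -/(E x') in eqx; rewrite -/(E y') in eqy.
(* Crossing the equilibrium at v with b - a removes the terms of a and b, which are parallel to
   it. *)
have wc : w v c = 0.
  apply: (mulIf cross); rewrite mul0r.
  transitivity (
    E x' * (y' b - y' a) -
    E y' * (x' b - x' a)).
    by rewrite /E /mid; field.
  by rewrite eqx eqy !mul0r subr0.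
have wab : w v a = w v b.
  apply: (mulIf cross); apply/eqP; rewrite -subr_eq0; apply/eqP.
  transitivity (- 2 *
    (E x' * (mid y' - y' c) -
    E y' * (mid x' - x' c))).
    by rewrite /E wc /mid; field.
  by rewrite eqx eqy !mul0r subr0 mulr0.
(* At a, the force w v a * (a - mid) equals (w v a / 2) * (a - b), and likewise at b, so the edge ab
   carries half the old value. *)
pose w1 i j := if (i == v) || (j == v) then 0 else
  if (i == a) && (j == b) || (i == b) && (j == a) then w v a / 2 else w i j.
have w1C i j : w1 i j = w1 j i.
  rewrite /w1 (wC j i); case: (i == v); case: (j == v); case: (i == a); case: (j == b);
  by case: (i == b); case: (j == a).
have wgab : w a b = 0.
  by apply: wg; move: gab; rewrite /del av bv !andbT.
have sum_w1 (z : T -> rat) :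
    (forall i, \sum_j w i j * (move_to v z (mid z) i - move_to v z (mid z) j) = 0) ->
    forall i, \sum_j w1 i j * (z i - z j) = 0.
  move=> wz i; have [->|iv] := eqVneq i v.
    by rewrite big1 // => j _; rewrite /w1 eqxx mul0r.
  rewrite (bigD1 v) //= {1}/w1 eqxx orbT mul0r add0r.
  have := wz i; rewrite (bigD1 v) //=.
  rewrite {1 2}/move_to eqxx (negPf iv) => wzi.
  have [iab|iab] := boolP (i \in [set a; b]).
    pose k := if i == a then b else a.
    have [kv kE iE] : [/\ k != v,
        w v i * (z i - mid z) + w v a / 2 * (z k - z i) = 0 & w i k = 0].
      move: iab; rewrite !inE /k => /orP[] /eqP ->.
        by rewrite eqxx; split=> //; rewrite /mid; field.
      by rewrite (eq_sym b a) (negPf ab); split=> //; rewrite -?wab ?(wC b) // /mid; field.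
    have w1k : w1 i k = w v a / 2.
      rewrite /w1 (negPf iv) (negPf kv) /=; move: iab; rewrite !inE /k => /orP[] /eqP ->.
        by rewrite !eqxx.
      by rewrite (eq_sym b a) (negPf ab) !eqxx.
    rewrite (bigD1 k) //= w1k; move: wzi; rewrite (bigD1 k) //= iE mul0r add0r => wzi.
    have -> : \sum_(j | (j != v) && (j != k)) w1 i j * (z i - z j) =
        \sum_(j | (j != v) && (j != k)) w i j * (move_to v z (mid z) i - move_to v z (mid z) j).
      apply: eq_bigr => j /andP[jv jk]; rewrite /w1 /move_to (negPf iv) (negPf jv) /=.
      case: ifP => // /orP[] /andP[/eqP ia /eqP jb]; case/eqP: jk; rewrite jb /k ia ?eqxx //.
      by rewrite (eq_sym b a) (negPf ab).
    move: (bigop _ _ _) wzi => rest wzi.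
    transitivity (w i v * (z i - mid z) + rest -
      (w v i * (z i - mid z) + w v a / 2 * (z k - z i))).
      by rewrite (wC i); ring.
    by rewrite wzi kE subrr.
  move: iab; rewrite !inE negb_or => /andP[ia ib].
  have wiv : w i v = 0.
    rewrite wC; have [/gS|/wg //] := boolP (g v i).
    by rewrite !inE (negPf ia) (negPf ib) => /eqP ->.
  rewrite -[RHS]wzi wiv mul0r add0r; apply: eq_bigr => j jv.
  by rewrite /w1 /move_to (negPf iv) (negPf jv) (negPf ia) (negPf ib).
have w10 : forall i j, w1 i j = 0.
  apply: free; split=> //; [|exact: sum_w1|exact: sum_w1].
  move=> i j; rewrite /add !negb_or => /and3P[ngij nab nba].
  rewrite /w1 (negPf nab) (negPf nba) /=; case: ifP => // /negbT.
  rewrite negb_or => /andP[iv jv].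
  by apply: wg; move: ngij; rewrite /del iv jv !andbT.
have wa : w v a = 0.
  have := w10 a b; rewrite /w1 (negPf av) (negPf bv) !eqxx /= => /eqP.
  by rewrite mulf_eq0 invr_eq0 pnatr_eq0 orbF => /eqP.
move=> j; have [/gS|/wg //] := boolP (g v j).
by rewrite !inE => /orP[/orP[]|] /eqP -> //; rewrite -wab.
Qed.

Theorem laman g : ssrbool.symmetric g -> irreflexive g -> sparse g ->
  exists x y : T -> rat, stressfree g x y.
Proof.
have [k] := ubnP #|active g|%N; elim: k => // k IHk in g *; rewrite ltnS => le_k gC g0 sg.
have [A0|] := eqVneq (active g) set0.
  exists (fun=> 0), (fun=> 0) => w [_ wg _ _] i j; apply: wg; apply/negP => gij.
  have : i \in active g by rewrite inE; apply/existsP; exists j.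
  by rewrite A0 inE.
case/(exists_low_degree gC g0 sg) => v vA deg_v.
have active_lt g' : (forall i, [exists j, g' i j] -> i != v /\ i \in active g) ->
    (#|active g'|%N < k)%N.
  move=> sub; apply: leq_trans le_k; apply: proper_card; apply/properP; split.
    by apply/subsetP => i; rewrite inE => /sub[].
  by exists v => //; rewrite inE; apply/negP => /sub[]; rewrite eqxx.
have del_active i : [exists j, del g v i j] -> i != v /\ i \in active g.
  case/existsP=> j /and3P[gij iv _]; split=> //.
  by rewrite inE; apply/existsP; exists j.
have sdel : sparse (del g v) by apply: sparse_sub sg => i j /and3P[].
have [x0 [y0 free0]] := IHk _ (active_lt _ del_active) (del_sym v gC) (del_irr v g0) sdel.
have nbr a : g v a -> a != v by apply: contraTneq => ->; rewrite g0.
have nbr_active a : g v a -> a \in active g.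
  by move=> gva; rewrite inE; apply/existsP; exists v; rewrite gC.
move defS: [set j | g v j] deg_v => S; have gS j : g v j -> j \in S by rewrite -defS inE.
have Sg j : j \in S -> g v j by rewrite -defS inE.
case/andP=> S_gt0; case: (ltngtP #|S|%N 3%N) => // cardS _.
  have [/eqP/cards1P[a Sa]|S1] := eqVneq #|S|%N 1%N.
    by apply: (@henneberg_deg1 g v a _ _ g0 _ free0) => j; rewrite -Sa; apply: gS.
  have /eqP/cards2P[a [b [ab Sab]]] : #|S|%N = 2%N.
    by move: cardS S1 S_gt0; case: #|S|%N => [|[|[|]]].
  have [ga gb] : g v a /\ g v b by split; apply: Sg; rewrite Sab !inE eqxx ?orbT.
  by apply: (henneberg1 g0 ab (nbr _ ga) (nbr _ gb) _ free0) => j; rewrite -Sab; apply: gS.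
have /card_gt0P[a aS] := S_gt0.
have : #|S :\ a|%N = 2%N by move: cardS; rewrite (cardsD1 a) aS => -[].
move/eqP/cards2P => [b [c [bc Sbc]]].
have Sabc : S = [set a; b; c] by rewrite -(setD1K aS) Sbc setUA.
have : b \in S :\ a by rewrite Sbc !inE eqxx.
have : c \in S :\ a by rewrite Sbc !inE eqxx orbT.
rewrite !inE eq_sym => /andP[ac /Sg gc]; rewrite eq_sym => /andP[ab /Sg gb].
have ga := Sg _ aS.
have step p q r : p != q -> p != r -> q != r -> g v p -> g v q -> S = [set p; q; r] ->
    ~~ del g v p q -> sparse (add (del g v) p q) -> exists x y : T -> rat, stressfree g x y.
  move=> pq pr qr gp gq Spqr gpq sadd.
  have lt_k : (#|active (add (del g v) p q)|%N < k)%N.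
    apply: active_lt => i /existsP[j /or3P[gij|/andP[/eqP -> _]|/andP[/eqP -> _]]].
    - by apply: del_active; apply/existsP; exists j.
    - by split; [apply: nbr | apply: nbr_active].
    - by split; [apply: nbr | apply: nbr_active].
  have [x1 [y1 free1]] := IHk _ lt_k (add_sym p q (del_sym v gC))
    (add_irr pq (del_irr v g0)) sadd.
  apply: (henneberg2 gC g0 pq pr qr (nbr _ gp) (nbr _ gq) _ gpq free1) => j.
  by rewrite -Spqr; apply: gS.
have [[n1 s1]|[n1 s1]|[n1 s1]] := degree3_reduction gC g0 sg ga gb gc ab ac bc.
- exact: (step a b c).
- by apply: (step a c b) => //; rewrite 1?eq_sym // Sabc setUAC.
- by apply: (step b c a) => //; rewrite 1?eq_sym // Sabc -setUA setUC.
Qed.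

End SparseGraphs.

(** * Stress-free frameworks have algebraically independent lengths *)

Section ChainRule.
Variables (F : fieldType) (N : nat) (u : 'I_N -> {poly F}).
Implicit Types f : {mpoly F[N]}.

Definition curve : {rmorphism {mpoly F[N]} -> {poly F}} := mmap polyC u.

Lemma curveC c : curve c%:MP = c%:P. Proof. exact: mmapC. Qed.
Lemma curveX i : curve 'X_i = u i. Proof. by rewrite [LHS]mmapX mmap1U. Qed.

Opaque curve.

Lemma curve_eval f t : (curve f).[t] = f.@[fun i => (u i).[t]].
Proof.
apply: (mpoly_rmorph_eq (f := horner_eval t \o curve)
  (g := meval (fun i => (u i).[t]))) => [c|i] /=.
  by rewrite curveC /horner_eval hornerC mevalC.
by rewrite curveX mevalXU.
Qed.

Lemma curve_deriv f : (curve f)^`() = \sum_i curve f^`M(i) * (u i)^`().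
Proof.
pose P f := (curve f)^`() = \sum_i curve f^`M(i) * (u i)^`().
have PD f1 f2 : P f1 -> P f2 -> P (f1 + f2).
  rewrite /P rmorphD derivD => -> ->; rewrite -big_split; apply: eq_bigr => i _.
  by rewrite mderivD rmorphD mulrDl.
have PM f1 f2 : P f1 -> P f2 -> P (f1 * f2).
  rewrite /P rmorphM derivM => -> ->; rewrite mulr_suml mulr_sumr -big_split.
  apply: eq_bigr => i _; rewrite mderivM rmorphD !rmorphM /=; ring.
have PC c : P c%:MP.
  rewrite /P curveC derivC big1 // => i _; by rewrite mderivC rmorph0 mul0r.
have PX j : P 'X_j.
  rewrite /P curveX (bigD1 j) //= mderivX mnm1E eqxx scale1r.
  have -> : (U_(j) - U_(j))%MM = 0%MM by apply/mnmP => k; rewrite mnmBE subnn mnm0E.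
  rewrite mpolyX0 rmorph1 mul1r big1 ?addr0 // => i /negPf ne.
  by rewrite mderivX mnm1E eq_sym ne scale0r rmorph0 mul0r.
elim/mpolyind: f => [|c m p _ _ IHp]; first by rewrite -(mpolyC0 N); apply: PC.
apply: (PD) IHp; rewrite -mul_mpolyC; apply: (PM); first exact: PC.
rewrite mpolyXE_id; elim/big_ind: _ => [|f1 f2|i _].
- by rewrite -mpolyC1; apply: PC.
- exact: PM.
- elim: (m i) => [|k IHk]; first by rewrite expr0 -mpolyC1; apply: PC.
  by rewrite exprS; apply: (PM) IHk.
Qed.

End ChainRule.

Section Derivatives.
Variables (N : nat).
Implicit Types f : {mpoly rat[N]}.

Lemma msupp_mderiv i f m : m \in msupp f^`M(i) -> (m + U_(i))%MM \in msupp f.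
Proof. by rewrite !mcoeff_msupp mcoeff_mderiv; apply: contraNneq => ->; rewrite mul0rn. Qed.

Lemma vars_mderiv i f : vars f^`M(i) \subset vars f.
Proof.
apply/subsetP => j; rewrite !inE => /hasP[m /msupp_mderiv mf mj].
by apply/hasP; exists (m + U_(i))%MM; rewrite // mnmDE ltn_addr.
Qed.

Lemma mderiv_notin i f : i \notin vars f -> f^`M(i) = 0.
Proof.
rewrite inE => /hasPn no_i; apply/mpolyP => m; rewrite mcoeff0; apply/eqP.
apply: contraT; rewrite -mcoeff_msupp => /msupp_mderiv /no_i.
by rewrite mnmDE mnm1E eqxx addn1.
Qed.

Lemma msize_mderiv i f : (msize f^`M(i) <= (msize f).-1)%N.
Proof.
rewrite msizeE; apply/bigmax_leqP_seq => m /msupp_mderiv /msize_mdeg_lt + _.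
by rewrite mdegD mdeg1 addn1; case: (msize f).
Qed.

Lemma mderiv_eq0 f : (forall i, f^`M(i) = 0) -> f = (f@_0)%:MP.
Proof.
move=> f0; apply/mpolyP => m; rewrite mcoeffC.
have [->|m0] := eqVneq m 0%MM; first by rewrite mulr1.
rewrite mulr0.
have [i mi] : exists i, (0 < m i)%N.
  apply: NNPP => no_i; case/eqP: m0; apply/mnmP => i; rewrite mnm0E; apply/eqP.
  by rewrite -leqn0 leqNgt; apply/negP => mi; apply: no_i; exists i.
have /mpolyP/(_ (m - U_(i))%MM) := f0 i; rewrite mcoeff0 mcoeff_mderiv submK.
  by move/eqP; rewrite mulrn_eq0 /= => /eqP.
apply/mnm_lepP => j; rewrite mnm1E; have [<-|//] := eqVneq i j; exact: mi.
Qed.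

End Derivatives.

Section AlgebraicIndependence.
Variables (n N : nat) (src tgt : 'I_N -> 'I_n).
Hypothesis src_tgt : forall k, (src k < tgt k)%N.
Hypothesis edge_inj : forall k l, src k = src l -> tgt k = tgt l -> k = l.
Variable S : {set 'I_N}.

Definition edge_rel : rel 'I_n := fun i j => [exists k in S,
  (src k == i) && (tgt k == j) || (src k == j) && (tgt k == i)].

Definition lengths (x y : 'I_n -> rat) (k : 'I_N) : rat :=
  (x (src k) - x (tgt k)) * (y (src k) - y (tgt k)).

(** Equilibrium in terms of edges and signed incidences, the form in which partial derivatives
    produce it. Since [src] is below [tgt], each pair of vertices carries at most one edge. *)
Lemma edge_stress x y (w : 'I_N -> rat) : stressfree edge_rel x y ->
    (forall k, k \notin S -> w k = 0) ->
    (forall i, \sum_k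
       w k * ((src k == i)%:R - (tgt k == i)%:R) * (x (src k) - x (tgt k)) = 0) ->
    (forall i, \sum_k
       w k * ((src k == i)%:R - (tgt k == i)%:R) * (y (src k) - y (tgt k)) = 0) ->
  forall k, w k = 0.
Proof.
move=> free wS wx wy.
pose c k i j : rat := ((src k == i) && (tgt k == j))%:R + ((src k == j) && (tgt k == i))%:R.
pose W i j := \sum_k w k * c k i j.
have WE k : W (src k) (tgt k) = w k.
  have cE l : c l (src k) (tgt k) = (l == k)%:R.
    rewrite /c [X in _ + X](_ : _ = 0) ?addr0.
      have [->|lk] := eqVneq l k; first by rewrite !eqxx.
      case: andP => // -[/eqP sl /eqP tl]; case/eqP: lk; exact: edge_inj.
    case: andP => // -[/eqP sl /eqP tl]; have := src_tgt l; have := src_tgt k.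
    by rewrite -sl -tl => lt1 lt2; have := ltn_trans lt1 lt2; rewrite ltnn.
  rewrite /W (bigD1 k) //= cE eqxx mulr1 big1 ?addr0 // => l /negPf ne.
  by rewrite cE ne mulr0.
have Wsum (z : 'I_n -> rat) i : \sum_j W i j * (z i - z j) =
    \sum_k w k * ((src k == i)%:R - (tgt k == i)%:R) * (z (src k) - z (tgt k)).
  under eq_bigr => j _ do rewrite /W mulr_suml.
  rewrite exchange_big; apply: eq_bigr => k _ /=.
  transitivity (w k * (\sum_j ((src k == i) && (tgt k == j))%:R * (z i - z j) +
      \sum_j ((src k == j) && (tgt k == i))%:R * (z i - z j))).
    by rewrite -big_split mulr_sumr; apply: eq_bigr => j _; rewrite /c /=; ring.
  rewrite -mulrA; congr (_ * _).
  rewrite (bigD1 (tgt k)) //= [X in _ + X + _]big1 => [|j /negPf ne]; last first.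
    by rewrite [tgt k == j]eq_sym ne andbF mul0r.
  rewrite (bigD1 (src k)) //= [X in _ + (_ + X)]big1 => [|j /negPf ne]; last first.
    by rewrite [src k == j]eq_sym ne mul0r.
  rewrite !eqxx andbT /=.
  have at_i (a b : 'I_n) : (a == i)%:R * (z i - z b) = (a == i)%:R * (z a - z b).
    by have [->|_] := eqVneq a i; rewrite ?mul0r.
  by rewrite !at_i; ring.
move=> k; rewrite -WE; apply: free; split=> [i j|i j|i|i].
- apply: eq_bigr => l _; rewrite /c; congr (_ * _); rewrite addrC.
  by congr (_%:R + _%:R).
- move=> nij; rewrite /W big1 // => l _.
  have [lS|/wS ->] := boolP (l \in S); last by rewrite mul0r.
  rewrite /c; suff : ~~ ((src l == i) && (tgt l == j) || (src l == j) && (tgt l == i)).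
    by rewrite negb_or => /andP[/negPf -> /negPf ->]; rewrite addr0 mulr0.
  by apply: contra nij => H; apply/existsP; exists l; rewrite lS.
- by rewrite Wsum.
- by rewrite Wsum.
Qed.

(* The partial derivatives of a relation f, evaluated at a framework, form a stress of it; they
   vanish on almost all points of any line through (x0, y0), hence everywhere. *)
Theorem algebraic_independence x0 y0 : stressfree edge_rel x0 y0 ->
  forall f : {mpoly rat[N]}, vars f \subset S ->
    (forall x y, f.@[lengths x y] = 0) -> f = 0.
Proof.
move=> free0 f; have [k] := ubnP (msize f); elim: k => // k IHk in f *.
rewrite ltnS => le_k fS f0.
have deriv_stress x y i : \sum_k (f^`M(k)).@[lengths x y] * ((src k == i)%:R - (tgt k == i)%:R)
    * (y (src k) - y (tgt k)) = 0.
  (* Only x i moves, at unit speed, so the lengths are affine in t. The chain rule at t = 0 is the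
     equilibrium at i in y; the one in x follows by exchanging x and y. *)
  pose u l : {poly rat} := (lengths x y l)%:P +
    (((src l == i)%:R - (tgt l == i)%:R) * (y (src l) - y (tgt l))) *: 'X.
  have u0 : curve u f = 0.
    apply: poly_vanish_eq0 => t; rewrite curve_eval.
    rewrite -[RHS](f0 (fun j => x j + t * (j == i)%:R) y).
    apply: meval_eq => l; rewrite /u /lengths hornerD hornerZ hornerC hornerX; ring.
  have /(congr1 (horner^~ 0)) := curve_deriv u f; rewrite u0 deriv0 horner0 horner_sum => E.
  rewrite [RHS]E; apply: eq_bigr => l _; rewrite hornerM curve_eval -mulrA; congr (_ * _).
    by apply: meval_eq => j; rewrite /u hornerD hornerZ hornerC hornerX mulr0 addr0.
  by rewrite /u derivD derivC derivZ derivX add0r alg_polyC hornerC.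
have flip x y : lengths x y =1 lengths y x by move=> l; rewrite /lengths mulrC.
have deriv0 l : f^`M(l) = 0.
  have [lf|] := boolP (l \in vars f); last exact: mderiv_notin.
  apply: IHk.
  - apply: leq_ltn_trans (msize_mderiv l f) _.
    rewrite prednK // lt0n msize_poly_eq0; apply: contraTneq lf => ->.
    by rewrite inE msupp0.
  - exact: subset_trans (vars_mderiv l f) fS.
  move=> x1 y1.
  have [h h0 freeh] := stressfree_line x1 y1 free0.
  pose line (z z1 : 'I_n -> rat) i : {poly rat} := (z i)%:P + (z1 i - z i) *: 'X.
  have lineE (z z1 : 'I_n -> rat) i t : (line z z1 i).[t] = along t z z1 i.
    by rewrite /line /along hornerD hornerZ hornerC hornerX mulrC.
  pose v j : {poly rat} := (line x0 x1 (src j) - line x0 x1 (tgt j)) *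
    (line y0 y1 (src j) - line y0 y1 (tgt j)).
  have vE j t : (v j).[t] = lengths (along t x0 x1) (along t y0 y1) j.
    by rewrite /v hornerM ![(_ - _).[_]]hornerD ![(- _).[_]]hornerN !lineE.
  have U0 : curve v f^`M(l) = 0.
    apply: (mulIf h0); rewrite mul0r; apply: poly_vanish_eq0 => t; rewrite hornerM.
    have [->|ht] := eqVneq h.[t] 0; first by rewrite mulr0.
    rewrite curve_eval (meval_eq _ (fun j => vE j t)).
    pose w j := (f^`M(j)).@[lengths (along t x0 x1) (along t y0 y1)].
    rewrite -/(w l) (edge_stress (freeh t ht)) ?mul0r // => [j jS|i|i]; last first.
    - exact: deriv_stress.
    - rewrite -[RHS](deriv_stress (along t y0 y1) (along t x0 x1) i).
      by apply: eq_bigr => j _; rewrite /w (meval_eq _ (flip _ _)).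
    - rewrite /w mderiv_notin ?meval0 //; apply: contra jS; exact: (subsetP fS).
  have := curve_eval v f^`M(l) 1; rewrite U0 horner0 => E; rewrite [RHS]E; apply: meval_eq => j.
  by rewrite vE /lengths /along; ring.
have fE := mderiv_eq0 deriv0; have := f0 (fun=> 0) (fun=> 0).
by rewrite {1}fE mevalC => f00; rewrite fE f00 mpolyC0.
Qed.

End AlgebraicIndependence.

(** * Circuit polynomials *)

Section MoreFactorial.
Variables (F : fieldType) (N : nat).
Implicit Types p q : {mpoly F[N]}.

Lemma vars_divides p q : q != 0 -> divides p q -> vars p \subset vars q.
Proof.
move=> q0 [r def_q]; apply/subsetP => i ip; apply: contraTT (univ_size ip) => iq.
rewrite -leqNgt; have r0 : univm F i r != 0.
  apply: contraNneq q0 => Ur; rewrite def_q -(univK i (r * p)) rmorphM Ur mul0r.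
  by rewrite horner0.
apply: leq_trans (leq_size_mull (univm F i p) r0) _.
by rewrite -rmorphM -def_q (univ_free iq) size_polyC leq_b1.
Qed.

Lemma mpoly_unitP p : p \is a GRing.unit -> exists2 c, c != 0 & p = c%:MP.
Proof. by case/andP => /eqP def_p; rewrite unitfE => c0; exists p@_0. Qed.

Lemma associate_scale p q : irreducible_elt p -> irreducible_elt q -> divides p q ->
  exists2 c, c != 0 & q = c *: p.
Proof.
move=> Ip Iq /(irreducible_divides_associate Ip Iq)[u /mpoly_unitP[c c0 ->] ->].
by exists c; rewrite ?mul_mpolyC.
Qed.

Lemma vars_scale c p : c != 0 -> vars (c *: p) = vars p.
Proof.
move=> c0; apply/setP => i; rewrite !inE.
by apply/hasP/hasP => -[m mp mi]; exists m => //; rewrite (perm_mem (msuppZ p c0)) in mp *.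
Qed.

End MoreFactorial.

Lemma prime_irreducible (R : idomainType) (p : R) : prime_elt p -> irreducible_elt p.
Proof.
case=> p0 nUp Pp; split=> //; split=> // a b def_p.
have half x y : p = x * y -> divides p x -> y \is a GRing.unit.
  move=> def [q def_x]; apply/unitrP; exists q.
  have x0 : x != 0 by apply: contraNneq p0 => x0; rewrite def x0 mul0r.
  have qy : q * y = 1 by apply: (mulfI x0); rewrite mulr1 {2}def_x def; ring.
  by rewrite [y * q]mulrC.
have [|dvd_a|dvd_b] := Pp a b; first by rewrite -def_p; apply: divides_refl.
  by right; apply: half dvd_a.
by left; apply: half dvd_b; rewrite mulrC.
Qed.

Section Graphs.
Variable n : nat.
Local Notation P := {mpoly rat[nv n]}.
Implicit Types (C S : {set edge n}) (e : edge n) (p q f : P).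

Definition vset S : {set 'I_(nv n)} := [set vidx e | e in S].

Lemma vidx_inj : injective (@vidx n). Proof. exact: enum_rank_inj. Qed.

Lemma mem_vset S e : (vidx e \in vset S) = (e \in S).
Proof. by rewrite mem_imset //; apply: vidx_inj. Qed.

Lemma vsetP S i : i \in vset S -> exists2 e, e \in S & i = vidx e.
Proof. by case/imsetP => e eS ->; exists e. Qed.

Lemma mem_supp p e : (e \in supp p) = (vidx e \in vars p).
Proof. by rewrite !inE. Qed.

Lemma supp_vset p S : (supp p \subset S) = (vars p \subset vset S).
Proof.
apply/subsetP/subsetP => sub i.
  by move=> ip; rewrite -(enum_valK i) mem_vset; apply: sub; rewrite mem_supp /vidx enum_valK.
by rewrite mem_supp => /sub; rewrite mem_vset.
Qed.

Lemma univ_univm e p : univ e p = univm rat (vidx e) p.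
Proof.
transitivity (mmap (polyC \o @mpolyC _ rat) (univX rat (vidx e)) p); last by [].
apply: eq_bigr => m _; rewrite /= -mul_mpolyC polyCM -mulrA; congr (_ * _).
have X1 : univX rat (vidx e) (vidx e) = 'X by rewrite /univX eqxx.
rewrite /mmap1 (bigD1 (vidx e)) //= X1 mulrC; congr (_ * _).
rewrite mpolyXE_id (bigD1 (vidx e)) //= mnmE eqxx expr0 mul1r rmorph_prod /=.
by apply: eq_bigr => i ne; rewrite /univX mnmE (negPf ne) rmorphXn.
Qed.

Lemma edge_lt (k : 'I_(nv n)) : (src k < tgt k)%N.
Proof. exact: (valP (enum_val k : edge n)). Qed.

Lemma src_tgt_inj (k l : 'I_(nv n)) : src k = src l -> tgt k = tgt l -> k = l.
Proof.
move=> s t; apply: enum_val_inj; apply: val_inj; move: s t; rewrite /src /tgt.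
by case: (val _) (val _) => [a b] [c d] /= -> ->.
Qed.

Lemma edge_neq e : (val e).1 != (val e).2.
Proof. by have := valP e; rewrite ltn_neqAle => /andP[]. Qed.

Lemma nb_arcs_span S (V : {set 'I_n}) :
  (nb_arcs (edge_rel (@src n) (@tgt n) (vset S)) V <= 2 * #|spanE S V|)%N.
Proof.
rewrite mulnC -sum_nat_const.
have two (e : edge n) : 2%N = (\sum_(i : 'I_n) \sum_(j : 'I_n)
    (((i == (val e).1) && (j == (val e).2)) + ((i == (val e).2) && (j == (val e).1))))%N.
  under eq_bigr => i _ do rewrite big_split.
  by rewrite big_split !sum_pair_delta.
under [leqRHS]eq_bigr => e _ do rewrite (two e).
rewrite exchange_big; apply: leq_sum => i _; rewrite exchange_big; apply: leq_sum => j _.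
case: (boolP [&& _, _ & _]) => // /and3P[/existsP[k /andP[kS ends]] iV jV].
have [e eS ke] := vsetP kS.
have eSV : e \in spanE S V.
  rewrite inE eS /=; move: ends; rewrite ke /src /tgt /vidx enum_rankK.
  by case/orP=> /andP[/eqP -> /eqP ->]; rewrite iV jV.
rewrite (bigD1 e) //=; apply: leq_trans (leq_addr _ _).
move: ends; rewrite ke /src /tgt /vidx enum_rankK.
by case/orP=> /andP[/eqP -> /eqP ->]; rewrite !eqxx ?leq_addr ?leq_addl.
Qed.

(** If V contains all vertices of C, deleting c lowers 2|vert C| - 2 to the bound. Otherwise the
    condition on proper subsets applies to [W], unless it has at most one vertex and spans
    nothing. *)
Lemma span_minus C c (V : {set 'I_n}) : rigidity_circuit C -> c \in C -> (2 <= #|V|)%N ->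
  (#|spanE (C :\ c) V| + 3 <= 2 * #|V|)%N.
Proof.
move=> [cardC subC] cC V2; pose W := V :&: vert C.
have WV : (#|W| <= #|V|)%N by apply/subset_leq_card/subsetIl.
have spanW : spanE (C :\ c) V \subset spanE C W.
  apply/subsetP => e; rewrite !inE => /and3P[/andP[_ eC] -> ->]; rewrite eC /=.
  by apply/andP; split; apply/existsP; exists e; rewrite eC eqxx ?orbT.
have [WC|WC] := eqVneq W (vert C).
  have : (#|spanE (C :\ c) V| <= #|C :\ c|)%N.
    by apply/subset_leq_card/subsetP => e; rewrite inE => /andP[].
  have := cardsD1 c C; rewrite cC; rewrite WC in WV.
  by move: cardC WV; clear; lia.
have Wprop : W \proper vert C by rewrite properEneq WC subsetIr.
have le_span := subset_leq_card spanW.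
have [W2|W1] := ltnP 1 #|W|.
  by have := subC _ Wprop W2; move: le_span WV; clear; lia.
suff span0 : spanE C W = set0 by move: le_span V2; rewrite span0 cards0; clear; lia.
apply/setP => e; rewrite [RHS]inE; apply/negbTE; rewrite inE; apply/negP => /and3P[_ e1 e2].
have E := card_le1_eqP W1 _ _ e1 e2.
by have := edge_neq e; rewrite E eqxx.
Qed.

Lemma sparse_minus C c : rigidity_circuit C -> c \in C ->
  sparse (edge_rel (@src n) (@tgt n) (vset (C :\ c))).
Proof.
move=> rC cC V V2; have := span_minus rC cC V2; have := nb_arcs_span (C :\ c) V.
by move: (nb_arcs _ V); clear; lia.
Qed.

(** Evaluating [phi] at rational coordinates shows that f vanishes on the lengths of every
    framework, and C minus c has a stress-free one. *)
Lemma inCM_independent C c f : rigidity_circuit C -> c \in C ->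
  supp f \subset C :\ c -> inCM f -> f = 0.
Proof.
move=> rC cC; rewrite supp_vset => fS /inCM_phi phi_f0.
have sg : sparse (edge_rel (@src n) (@tgt n) (vset (C :\ c))).
  exact: sparse_minus.
have gC : ssrbool.symmetric (edge_rel (@src n) (@tgt n) (vset (C :\ c))).
  by move=> i j; apply: eq_existsb => k; rewrite orbC.
have g0 : irreflexive (edge_rel (@src n) (@tgt n) (vset (C :\ c))).
  move=> i; apply/negbTE/existsP => -[k /andP[_ /orP[] /andP[/eqP s /eqP t]]];
  by have := edge_lt k; rewrite s t ltnn.
have [x0 [y0 free]] := laman gC g0 sg.
apply: (algebraic_independence edge_lt src_tgt_inj free fS) => x y.
pose z (i : 'I_(n + n)) := match split i with inl a => x a | inr b => y b end.
have := congr1 (meval z) phi_f0; rewrite meval0 => <-.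
apply: (mpoly_rmorph_eq (f := meval (lengths (@src n) (@tgt n) x y))
  (g := meval z \o phi n)) => [a|k] /=.
  by rewrite mmapC !mevalC.
rewrite mmapX mmap1U mevalXU mevalM !mevalB !mevalXU /z /lengths.
by rewrite !(unsplitK (inl _)) !(unsplitK (inr _)).
Qed.


Lemma rigidity_circuit_edge C : rigidity_circuit C -> exists c, c \in C.
Proof.
move=> [cardC _]; apply/set0Pn; apply: contraTneq isT => C0.
have vert0 : vert C = set0.
  by apply/setP => v; rewrite !inE; apply/negbTE/existsP => -[e]; rewrite C0 inE.
by move: cardC; rewrite vert0 C0 !cards0.
Qed.

Lemma ResE p q e : Res p q e = res (vidx e) p q.
Proof. by rewrite /Res !univ_univm. Qed.

Lemma inCM_res e p q : e \in supp p -> e \in supp q -> inCM p -> inCM q -> inCM (Res p q e).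
Proof.
rewrite !mem_supp => ep eq Ip Iq; rewrite ResE.
have [u [v ->]] := res_ideal ep eq.
by apply: inCMD; apply: inCMM.
Qed.

Lemma supp_Res e p q S : e \in supp p -> e \in supp q ->
  supp p \subset S -> supp q \subset S -> supp (Res p q e) \subset S :\ e.
Proof.
move=> ep eq pS qS; have eS := subsetP pS e ep.
have SE : vidx e |: vset S = vset S by apply/setUidPr; rewrite sub1set mem_vset.
rewrite supp_vset ResE.
have -> : vset (S :\ e) = vset S :\ vidx e.
  apply/setP => i; rewrite -(enum_valK i) mem_vset !inE mem_vset.
  by rewrite (inj_eq vidx_inj).
by apply: vars_res; rewrite ?SE -?supp_vset // -mem_supp.
Qed.

Lemma circuit_poly_divides C pC f : rigidity_circuit C -> circuit_poly C pC ->
  inCM f -> supp f \subset C -> divides (pC : P) f.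
Proof.
move=> rC [ICM [IpC suppC]] If fC; have [c cC] := rigidity_circuit_edge rC.
have [cf|cf] := boolP (c \in supp f); last first.
  exists 0; rewrite mul0r; apply: (inCM_independent rC cC) => //.
  by rewrite subsetD1 fC.
apply: (@res_eq0_divides _ _ _ _ (vidx c)) => //; first by rewrite -mem_supp suppC.
rewrite -ResE; apply: (inCM_independent rC cC).
  by apply: supp_Res; rewrite ?suppC.
by apply: inCM_res; rewrite ?suppC.
Qed.

Lemma circuit_poly_unique C pC f : rigidity_circuit C -> circuit_poly C pC ->
    irreducible_elt (f : P) -> inCM f -> supp f \subset C ->
  exists c : rat, c != 0 /\ f = c *: pC.
Proof.
move=> rC cC If fCM fC; have IpC : irreducible_elt (pC : P) by case: cC => _ [].
have [c c0 ->] := associate_scale IpC If (circuit_poly_divides rC cC fCM fC).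
by exists c.
Qed.

(** An edge of C missing from the support would make f zero by independence. *)
Lemma irreducible_circuit_poly C f : rigidity_circuit C ->
  irreducible_elt (f : P) -> inCM f -> supp f \subset C -> circuit_poly C f.
Proof.
move=> rC If fCM fC; split=> //; split=> //.
apply/eqP; rewrite eqEsubset fC; apply/subsetP => c cC.
apply: contraT => cf; case: If => /eqP[]; apply: (inCM_independent rC cC) => //.
by rewrite subsetD1 fC.
Qed.

(** The target of [phi] is a domain, so [phi] kills one of the prime factors; [phi_inCM], with base
    point o, puts it in CM_n. *)
Lemma inCM_irreducible_factor (o : 'I_n) f : f != 0 -> inCM f ->
  exists q : P, [/\ irreducible_elt q, inCM q & divides q f].
Proof.
move=> f0 /inCM_phi phi_f; have [u [s [Uu Ps def_f]]] := mpoly_factorial f0.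
have [q qs phi_q] : exists2 q, q \in s & phi n q = 0.
  move: phi_f; rewrite def_f rmorphM rmorph_prod => /eqP; rewrite mulf_eq0.
  have -> : (phi n u == 0) = false.
    apply/negbTE; apply: contraTneq (rmorph_unit (phi n) Uu) => ->.
    by rewrite unitr0.
  by rewrite prodf_seq_eq0 => /hasP[q qs /eqP phi_q]; exists q.
exists q; split; [exact/prime_irreducible/Ps | exact: phi_inCM | ].
rewrite def_f (big_rem q) //=; exists (u * \prod_(y <- rem q s) y); ring.
Qed.

(** * Complete graphs on four vertices *)

Definition clique (V : {set 'I_n}) : {set edge n} :=
  [set e | ((val e).1 \in V) && ((val e).2 \in V)].

Lemma edge_of_pair (i j : 'I_n) : i != j -> exists e : edge n,
  ((val e).1 = i /\ (val e).2 = j) \/ ((val e).1 = j /\ (val e).2 = i).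
Proof.
move=> ij; case: (ltngtP i j) => [lt|lt|/val_inj eq]; last by rewrite eq eqxx in ij.
  by exists (exist _ (i, j) lt); left.
by exists (exist _ (j, i) lt); right.
Qed.

Lemma card_clique (V : {set 'I_n}) : #|clique V| = 'C(#|V|, 2).
Proof.
rewrite -cards_draws; pose ends (e : edge n) : {set 'I_n} := [set (val e).1; (val e).2].
have ends_inj : injective ends.
  move=> e e' E; apply: val_inj; have := valP e; have := valP e'.
  have e1 : (val e).1 \in ends e' by rewrite -E !inE eqxx.
  have e2 : (val e).2 \in ends e' by rewrite -E !inE eqxx orbT.
  have := edge_neq e; move: e1 e2; rewrite !inE; case: (val e) (val e') => [i j] [k l] /=.
  move=> /orP[] /eqP -> /orP[] /eqP -> //; rewrite ?eqxx //.
  by move=> _ lt1 lt2; have := ltn_trans lt1 lt2; rewrite ltnn.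
rewrite -(card_imset _ ends_inj); congr #|pred_of_set _|; apply/setP => A; rewrite inE.
apply/imsetP/andP => [[e + ->]|[AV /cards2P[i [j [ij def_A]]]]].
  rewrite inE => /andP[e1 e2]; rewrite cards2 edge_neq; split=> //.
  by apply/subsetP => i; rewrite !inE => /orP[] /eqP ->.
have [e ends_e] := edge_of_pair ij; exists e; last first.
  by rewrite def_A /ends; case: ends_e => -[-> ->] //; rewrite setUC.
have iV : i \in V by apply: (subsetP AV); rewrite def_A !inE eqxx.
have jV : j \in V by apply: (subsetP AV); rewrite def_A !inE eqxx orbT.
by rewrite inE; case: ends_e => -[-> ->]; rewrite iV jV.
Qed.

Lemma clique4_rigidity_circuit (V : {set 'I_n}) : #|V| = 4%N -> rigidity_circuit (clique V).
Proof.
move=> V4; have vertV : vert (clique V) = V.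
  apply/setP => v; rewrite inE; apply/existsP/idP => [[e /andP[]]|vV].
    by rewrite inE => /andP[e1 e2] /orP[] /eqP ->.
  have [u] : exists u, u \in V :\ v.
    by apply/set0Pn; rewrite -card_gt0; move: V4; rewrite (cardsD1 v) vV add1n => -[->].
  rewrite !inE eq_sym => /andP[vu uV]; have [e ends_e] := edge_of_pair vu; exists e.
  by rewrite inE; case: ends_e => -[-> ->]; rewrite vV uV eqxx ?orbT.
split; first by rewrite vertV card_clique V4.
rewrite vertV => W WV W2.
have : spanE (clique V) W \subset clique W.
  by apply/subsetP => e; rewrite !inE => /andP[_].
move/subset_leq_card; rewrite card_clique.
have := proper_card WV; rewrite V4; case: #|W| W2 => [|[|[|[|k]]]] // _ _ le_span.
- by rewrite (leq_add le_span).
- by rewrite (leq_add le_span).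
Qed.

Lemma meval_xx (i j : 'I_n) : (xx i j : P).@[fun=> 1] = (i != j)%:R.
Proof.
have [->|[k [] [<- <-]]] := xxP i j; first by rewrite xx_diag meval0 eqxx.
  by rewrite xx_edge mevalXU neq_ltn edge_lt.
by rewrite xxC xx_edge mevalXU neq_ltn edge_lt orbT.
Qed.

Lemma keep_xx (V : {set 'I_n}) (i j : 'I_n) : i \in V -> j \in V ->
  keep rat (vset (clique V)) (xx i j) = xx i j.
Proof.
have keep_edge k : src k \in V -> tgt k \in V ->
    keep rat (vset (clique V)) 'X_k = 'X_k.
  move=> sV tV; rewrite keepXU /keepX -(enum_valK k) -/(vidx _) mem_vset inE.
  by move: sV tV; rewrite /src /tgt => -> ->.
have [->|[k [] [<- <-]]] := xxP i j; first by rewrite xx_diag rmorph0.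
  by rewrite xx_edge => sV tV; apply: keep_edge.
by rewrite xxC xx_edge => tV sV; apply: keep_edge.
Qed.

(* The Cayley-Menger determinant of four points is nonzero when all squared lengths are 1. *)
Lemma clique4_minor (V : {set 'I_n}) : #|V| = 4%N ->
  exists f : P, [/\ f != 0, inCM f & supp f \subset clique V].
Proof.
move=> V4; pose v (i : 'I_4) : 'I_n := enum_val (cast_ord (esym V4) i).
have vV i : v i \in V by apply: enum_valP.
have v_inj : injective v by move=> i j /enum_val_inj/cast_ord_inj.
pose r (a : 'I_5) : 'I_n.+1 := if unlift ord0 a is Some i then lift ord0 (v i) else ord0.
exists (minor5 r r); split.
- pose J : 'M[rat]_5 := \matrix_(a, b) (a != b)%:R.
  (* With E the all-ones matrix, E * E = 5 E, so E / 4 - 1 is inverse to J = E - 1. *)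
  pose J' : 'M[rat]_5 := \matrix_(a, b) (4^-1 - (a == b)%:R).
  have JJ' : J *m J' = 1%:M.
    apply/matrixP => a b; rewrite !mxE !big_ord_recl big_ord0 !mxE.
    by case: a b => [[|[|[|[|[|a]]]]] lt_a] [[|[|[|[|[|b]]]]] lt_b].
  have detJ : \det J != 0.
    apply: contraTneq (oner_neq0 rat) => J0.
    by rewrite -(det1 rat 5) -JJ' det_mulmx J0 mul0r eqxx.
  apply: contraNneq detJ => minor0.
  have := meval0 (fun _ : 'I_(nv n) => 1 : rat); rewrite -minor0 /minor5 -det_map_mx => detE.
  rewrite -detE; apply/eqP; congr (\det _); apply/matrixP => a b; rewrite !mxE /r.
  case: (unliftP ord0 a) => [i|] ->; case: (unliftP ord0 b) => [j|] ->;
    rewrite ?liftK ?unlift_none.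
  - rewrite [RHS]meval_xx (inj_eq v_inj); congr (~~ _)%:R; exact: inj_eq lift_inj _ _.
  - by rewrite [RHS]rmorph1 eq_sym neq_lift.
  - by rewrite [RHS]rmorph1 neq_lift.
  - by rewrite [RHS]rmorph0 eqxx.
(* Passing through [phi] gives membership for any index function, increasing or not. *)
- exact: (@phi_inCM n (v ord0) _ (phi_minor5 r r)).
rewrite supp_vset vars_keep /minor5 -det_map_mx; apply/eqP; congr (\det _).
apply/matrixP => a b; rewrite !mxE /r.
case: (unlift ord0 a) => [i|]; case: (unlift ord0 b) => [j|];
  rewrite ?liftK ?unlift_none ?rmorph0 ?rmorph1 //.
by rewrite keep_xx.
Qed.


Lemma isK4_rigidity_circuit C : isK4 C -> rigidity_circuit C.
Proof. by case=> V [V4 ->]; apply: clique4_rigidity_circuit. Qed.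

Lemma isK4_circuit_poly C : isK4 C -> exists p : P, circuit_poly C p.
Proof.
move=> K4C; have rC := isK4_rigidity_circuit K4C; case: K4C => V [V4 def_C].
have [f [f0 fCM fC]] := clique4_minor V4.
have [v _] : exists v, v \in V by apply/set0Pn; rewrite -card_gt0 V4.
have [q [Iq qCM qf]] := inCM_irreducible_factor v f0 fCM.
exists q; apply: irreducible_circuit_poly => //.
rewrite supp_vset; apply: subset_trans (vars_divides f0 qf) _.
by rewrite -supp_vset def_C.
Qed.

Section ResultantStep.
Variables (A B : {set edge n}) (e : edge n) (pA pB : P).
Hypotheses (AB : A != B) (eA : e \in A) (eB : e \in B).
Hypotheses (cA : circuit_poly A pA) (cB : circuit_poly B pB).

Lemma Res_circuit_neq0 : Res pA pB e != 0.
Proof.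
have [[_ [IA sA]] [_ [IB sB]]] := (cA, cB).
apply/eqP; rewrite ResE => res0; have epA : vidx e \in vars pA by rewrite -mem_supp sA.
have [c c0 def_pB] := associate_scale IA IB (res_eq0_divides IA epA res0).
case/eqP: AB; rewrite -sA -sB; apply/setP => k.
by rewrite [in LHS]mem_supp [in RHS]mem_supp def_pB vars_scale.
Qed.

Lemma Res_circuit_inCM : inCM (Res pA pB e).
Proof.
by case: cA cB => ? [_ sA] [? [_ sB]]; apply: inCM_res; rewrite ?sA ?sB.
Qed.

Lemma Res_circuit_supp : supp (Res pA pB e) \subset CR A B e.
Proof.
case: cA cB => _ [_ sA] [_ [_ sB]].
by apply: supp_Res; rewrite ?sA ?sB ?subsetUl ?subsetUr.
Qed.

Lemma Res_factor_supp f : divides f (Res pA pB e) -> supp f \subset CR A B e.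
Proof.
move=> /(vars_divides Res_circuit_neq0) sub; rewrite supp_vset.
by apply: subset_trans sub _; rewrite -supp_vset; apply: Res_circuit_supp.
Qed.

End ResultantStep.

(** The claims go by a joint induction: a nonzero resultant at a node requires that the polynomials
    obtained below are circuit polynomials of the children. *)
Lemma resultant_tree_circuits (t : rtree n) : resultant_tree t ->
  [/\ rigidity_circuit (rroot t), exists q, obtained t q &
      forall q, obtained t q -> circuit_poly (rroot t) q].
Proof.
elim: t => [G|G e l IHl r IHr] /=.
  by move=> K4G; split=> //; [apply: isK4_rigidity_circuit | apply: isK4_circuit_poly].
case=> /IHl[rl [ql ol] cl] [/IHr[rr [qr or] cr] [lr [el [er [-> rG]]]]].
split=> //.
  have cql := cl _ ol; have cqr := cr _ or.
  have R0 := Res_circuit_neq0 lr el cql cqr.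
  have [q [Iq qCM qR]] := inCM_irreducible_factor (val e).1 R0 (Res_circuit_inCM el er cql cqr).
  by exists q, ql, qr.
move=> q [ql' [qr' [/cl cql [/cr cqr [Iq [qCM qR]]]]]].
apply: irreducible_circuit_poly => //.
exact: (Res_factor_supp lr el er cql cqr qR).
Qed.

End Graphs.

Theorem theorem2 (n : nat) :
  (forall (A B C : {set edge n}) (e : edge n) (pA pB pC : Xpoly n),
     rigidity_circuit A -> rigidity_circuit B -> A != B ->
     e \in A -> e \in B -> C = CR A B e -> rigidity_circuit C ->
     circuit_poly A pA -> circuit_poly B pB -> circuit_poly C pC ->
     [/\ Res pA pB e != 0,
         inCM (Res pA pB e),
         supp (Res pA pB e) \subset C,
         dvdMP pC (Res pA pB e) &
         forall f : Xpoly n, irreducibleMP f -> dvdMP f (Res pA pB e) -> inCM f ->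
           exists c : rat, c != 0 /\ f = c *: pC]) /\
  (forall (C : {set edge n}) (pC : Xpoly n) (t : rtree n),
     resultant_tree t -> rroot t = C -> circuit_poly C pC ->
     (exists q, obtained t q) /\
     (forall q, obtained t q -> exists c : rat, c != 0 /\ q = c *: pC)).
Proof.
split=> [A B C e pA pB pC _ _ AB eA eB -> rC cA cB cC | C pC t tree_t def_C cC].
  have RCM := Res_circuit_inCM eA eB cA cB.
  have RC := Res_circuit_supp eA eB cA cB.
  split=> //; first exact: (Res_circuit_neq0 AB eA cA cB).
    exact: (circuit_poly_divides rC cC RCM RC).
  move=> f If dvd_f fCM; apply: (circuit_poly_unique rC cC If fCM).
  exact: (Res_factor_supp AB eA eB cA cB dvd_f).
have [rC obt ctree] := resultant_tree_circuits tree_t; rewrite def_C in rC ctree.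
split=> // q /ctree[qCM [Iq sq]].
by apply: (circuit_poly_unique rC cC Iq qCM); rewrite sq.
Qed.
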